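(* For any two finite posets $X$ and $Z$, the posets $X\oplus\mathbf{1}\oplus Z$ and $\mathbf{1}\oplus(X+Z)$ are universally derived equivalent. Hence the posets $X\oplus\mathbf{1}\oplus Z$ and $Z\oplus\mathbf{1}\oplus X$ are universally derived equivalent.
   Context: $\mathbf{1}$ denotes the poset with one element. The ordinal sum $P\oplus Q$ of posets $(P,\le_P)$ and $(Q,\le_Q)$ is the poset on $P\sqcup Q$ with $x\le y$ iff ($x,y\in P$ and $x\le_P y$) or ($x,y\in Q$ and $x\le_Q y$) or ($x\in P$ and $y\in Q$). The direct sum $P+Q$ is the poset on $P\sqcup Q$ with $x\le y$ iff ($x,y\in P$ and $x\le_P y$) or ($x,y\in Q$ and $x\le_Q y$). For a poset $P$ (viewed as a small category with a unique morphism $p\to p'$ if $p\le p'$ and none otherwise) and a category $\mathcal{A}$, $\mathcal{A}^P$ denotes the category of functors $P\to\mathcal{A}$. If $\mathcal{A}$ is abelian, so is $\mathcal{A}^P$, and $D(\mathcal{A}^P)$ denotes its (unbounded) derived category with its standard triangulated structure. Two posets $P$ and $Q$ are universally derived equivalent if for every abelian category $\mathcal{A}$ the derived categories $D(\mathcal{A}^P)$ and $D(\mathcal{A}^Q)$ are equivalent as triangulated categories. *)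

(* Defs.v *)
From HB Require Import structures.
From mathcomp Require Import all_boot all_order all_algebra.
From mathcomp Require Import boolp.

Set Implicit Arguments.
Unset Strict Implicit.
Unset Printing Implicit Defensive.

Import Order.TTheory GRing.Theory.
Local Open Scope ring_scope.

Declare Scope cat_scope.
Local Open Scope cat_scope.

Fact ordsum_display (d1 d2 : Order.disp_t) : Order.disp_t.
Proof. exact: Order.Disp tt tt. Qed.

Fact dirsum_display (d1 d2 : Order.disp_t) : Order.disp_t.
Proof. exact: Order.Disp tt tt. Qed.

Definition ordsum (P Q : Type) : Type := (P + Q)%type.
Definition dirsum (P Q : Type) : Type := (P + Q)%type.

HB.instance Definition _ (P Q : choiceType) :=
  Choice.copy (ordsum P Q) (P + Q)%type.
HB.instance Definition _ (P Q : choiceType) :=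
  Choice.copy (dirsum P Q) (P + Q)%type.

Section SumOrders.
Variables (d1 d2 : Order.disp_t) (P : porderType d1) (Q : porderType d2).

Definition ordsum_le (x y : ordsum P Q) : bool :=
  match x, y with
  | inl a, inl b => (a <= b)%O
  | inr a, inr b => (a <= b)%O
  | inl _, inr _ => true
  | inr _, inl _ => false
  end.

Definition dirsum_le (x y : dirsum P Q) : bool :=
  match x, y with
  | inl a, inl b => (a <= b)%O
  | inr a, inr b => (a <= b)%O
  | _, _ => false
  end.

Fact ordsum_le_refl : reflexive ordsum_le.
Proof. by case=> x /=. Qed.

Fact ordsum_le_anti : antisymmetric ordsum_le.
Proof. by case=> x [] y //= /le_anti ->. Qed.

Fact ordsum_le_trans : transitive ordsum_le.
Proof. by case=> y [] x [] z //=; apply: le_trans. Qed.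

Fact dirsum_le_refl : reflexive dirsum_le.
Proof. by case=> x /=. Qed.

Fact dirsum_le_anti : antisymmetric dirsum_le.
Proof. by case=> x [] y //= /le_anti ->. Qed.

Fact dirsum_le_trans : transitive dirsum_le.
Proof. by case=> y [] x [] z //=; apply: le_trans. Qed.

HB.instance Definition _ := Order.Le_isPOrder.Build (ordsum_display d1 d2)
  (ordsum P Q) ordsum_le_refl ordsum_le_anti ordsum_le_trans.
HB.instance Definition _ := Order.Le_isPOrder.Build (dirsum_display d1 d2)
  (dirsum P Q) dirsum_le_refl dirsum_le_anti dirsum_le_trans.
End SumOrders.

Record category : Type := Category {
  obj :> Type;
  hom : obj -> obj -> Type;
  idm : forall x, hom x x;
  comp : forall x y z, hom y z -> hom x y -> hom x z;
  comp1m : forall x y (f : hom x y), comp (idm y) f = f;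
  compm1 : forall x y (f : hom x y), comp f (idm x) = f;
  compA : forall x y z t (h : hom z t) (g : hom y z) (f : hom x y),
    comp h (comp g f) = comp (comp h g) f }.

Arguments hom {c} x y.
Arguments idm {c} x.
Arguments comp {c x y z} g f.

Notation "g \mo f" := (comp g f) (at level 40, left associativity) : cat_scope.

Definition is_iso (C : category) (x y : C) (f : hom x y) : Prop :=
  exists g : hom y x, g \mo f = idm x /\ f \mo g = idm y.

Definition mono (C : category) (x y : C) (f : hom x y) : Prop :=
  forall w (g h : hom w x), f \mo g = f \mo h -> g = h.

Definition epi (C : category) (x y : C) (f : hom x y) : Prop :=
  forall z (g h : hom y z), g \mo f = h \mo f -> g = h.

Record functor (C D : category) : Type := Functor {
  fobj :> C -> D;
  fmap : forall x y, hom x y -> hom (fobj x) (fobj y);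
  fmap_id : forall x, fmap (idm x) = idm (fobj x);
  fmap_comp : forall x y z (g : hom y z) (f : hom x y),
    fmap (g \mo f) = fmap g \mo fmap f }.

Arguments fmap {C D} F {x y} f : rename.

Definition functor_id (C : category) : functor C C :=
  @Functor C C id (fun _ _ f => f) (fun _ => erefl) (fun _ _ _ _ _ => erefl).

Section FunctorComp.
Variables (C D E : category) (G : functor D E) (F : functor C D).

Fact functor_comp_id (x : C) : fmap G (fmap F (idm x)) = idm (G (F x)).
Proof. by rewrite !fmap_id. Qed.

Fact functor_comp_comp (x y z : C) (g : hom y z) (f : hom x y) :
  fmap G (fmap F (g \mo f)) = fmap G (fmap F g) \mo fmap G (fmap F f).
Proof. by rewrite !fmap_comp. Qed.

Definition functor_comp : functor C E :=
  @Functor C E (fun x => G (F x)) (fun _ _ f => fmap G (fmap F f))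
    functor_comp_id functor_comp_comp.
End FunctorComp.

Record nat_trans (C D : category) (F G : functor C D) : Type := NatTrans {
  ntc :> forall x, hom (F x) (G x);
  nt_natural : forall x y (f : hom x y), ntc y \mo fmap F f = fmap G f \mo ntc x }.

Definition is_nat_iso (C D : category) (F G : functor C D)
  (a : nat_trans F G) : Prop := forall x, is_iso (a x).

Definition is_equivalence (C D : category) (F : functor C D) : Prop :=
  exists G : functor D C,
    (exists a : nat_trans (functor_comp G F) (functor_id C), is_nat_iso a) /\
    (exists b : nat_trans (functor_comp F G) (functor_id D), is_nat_iso b).

Record zcategory : Type := ZCategory {
  zcat :> category;
  zhom : forall x y : zcat, GRing.Zmodule (hom x y) }.

HB.instance Definition _ (A : zcategory) (x y : A) :=
  GRing.Zmodule.copy (hom x y) (GRing.Zmodule.Pack (zhom x y)).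

Definition is_kernel (A : zcategory) (x y k : A) (f : hom x y) (i : hom k x) :=
  f \mo i = 0 /\
  forall w (g : hom w x), f \mo g = 0 -> exists! h : hom w k, i \mo h = g.

Definition is_cokernel (A : zcategory) (x y c : A) (f : hom x y) (q : hom y c) :=
  q \mo f = 0 /\
  forall w (g : hom y w), g \mo f = 0 -> exists! h : hom c w, h \mo q = g.

(* The zero object, biproducts, kernels and cokernels are chosen as data; by the
   axiom of choice every abelian category admits such a choice. *)
Record abelian : Type := Abelian {
  ab_cat :> zcategory;
  compDl : forall (x y z : ab_cat) (g g' : hom y z) (f : hom x y),
    (g + g') \mo f = g \mo f + g' \mo f;
  compDr : forall (x y z : ab_cat) (g : hom y z) (f f' : hom x y),
    g \mo (f + f') = g \mo f + g \mo f';
  zob : ab_cat;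
  zob_term : forall x (f : hom x zob), f = 0;
  zob_init : forall x (f : hom zob x), f = 0;
  bip : ab_cat -> ab_cat -> ab_cat;
  in1 : forall x y, hom x (bip x y);
  in2 : forall x y, hom y (bip x y);
  pr1 : forall x y, hom (bip x y) x;
  pr2 : forall x y, hom (bip x y) y;
  pr1_in1 : forall x y, pr1 x y \mo in1 x y = idm x;
  pr2_in2 : forall x y, pr2 x y \mo in2 x y = idm y;
  pr1_in2 : forall x y, pr1 x y \mo in2 x y = 0;
  pr2_in1 : forall x y, pr2 x y \mo in1 x y = 0;
  bip_id : forall x y,
    in1 x y \mo pr1 x y + in2 x y \mo pr2 x y = idm (bip x y);
  ker : forall x y : ab_cat, hom x y -> ab_cat;
  kerm : forall (x y : ab_cat) (f : hom x y), hom (ker f) x;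
  kermP : forall (x y : ab_cat) (f : hom x y), is_kernel f (kerm f);
  coker : forall x y : ab_cat, hom x y -> ab_cat;
  cokerm : forall (x y : ab_cat) (f : hom x y), hom y (coker f);
  cokermP : forall (x y : ab_cat) (f : hom x y), is_cokernel f (cokerm f);
  mono_normal : forall (x y : ab_cat) (f : hom x y),
    mono f -> is_kernel (cokerm f) f;
  epi_normal : forall (x y : ab_cat) (f : hom x y),
    epi f -> is_cokernel (kerm f) f }.

Arguments in1 {a} x y.
Arguments in2 {a} x y.
Arguments pr1 {a} x y.
Arguments pr2 {a} x y.

Section AbelianTheory.
Variable A : abelian.
Implicit Types x y z w : A.

Lemma comp0m x y z (f : hom x y) : (0 : hom y z) \mo f = 0.
Proof. by apply: (addrI (0 \mo f)); rewrite -compDl !addr0. Qed.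

Lemma compm0 x y z (g : hom y z) : g \mo (0 : hom x y) = 0.
Proof. by apply: (addrI (g \mo 0)); rewrite -compDr !addr0. Qed.

Lemma compNm x y z (g : hom y z) (f : hom x y) : (- g) \mo f = - (g \mo f).
Proof. by apply: (addrI (g \mo f)); rewrite -compDl !subrr comp0m. Qed.

Lemma compmN x y z (g : hom y z) (f : hom x y) : g \mo (- f) = - (g \mo f).
Proof. by apply: (addrI (g \mo f)); rewrite -compDr !subrr compm0. Qed.

Definition ker_lift x y w (f : hom x y) (g : hom w x) (E : f \mo g = 0) :
  hom w (ker f) := projT1 (cid ((kermP f).2 w g E)).

Lemma ker_liftE x y w (f : hom x y) (g : hom w x) (E : f \mo g = 0) :
  kerm f \mo ker_lift E = g.
Proof. by rewrite /ker_lift; case: cid => h []. Qed.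

Lemma comp_kerm x y (f : hom x y) : f \mo kerm f = 0.
Proof. exact: (kermP f).1. Qed.

Lemma kerm_mono x y (f : hom x y) : mono (kerm f).
Proof.
move=> w g h E; have E0 : f \mo (kerm f \mo g) = 0.
  by rewrite compA comp_kerm comp0m.
by have [k [_ ku]] := (kermP f).2 _ _ E0; rewrite -(ku g erefl) -(ku h (esym E)).
Qed.

Definition coker_desc x y w (f : hom x y) (g : hom y w) (E : g \mo f = 0) :
  hom (coker f) w := projT1 (cid ((cokermP f).2 w g E)).

Lemma coker_descE x y w (f : hom x y) (g : hom y w) (E : g \mo f = 0) :
  coker_desc E \mo cokerm f = g.
Proof. by rewrite /coker_desc; case: cid => h []. Qed.

Lemma cokerm_comp x y (f : hom x y) : cokerm f \mo f = 0.
Proof. exact: (cokermP f).1. Qed.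

Lemma cokerm_epi x y (f : hom x y) : epi (cokerm f).
Proof.
move=> w g h E; have E0 : (g \mo cokerm f) \mo f = 0.
  by rewrite -compA cokerm_comp compm0.
by have [k [_ ku]] := (cokermP f).2 _ _ E0; rewrite -(ku g erefl) -(ku h (esym E)).
Qed.

End AbelianTheory.

Section PosetCategory.
Variables (d : Order.disp_t) (P : porderType d).

Definition poset_cat : category :=
  @Category P (fun p q => (p <= q)%O) (fun p => lexx p)
    (fun _ _ _ g f => le_trans f g)
    (fun _ _ _ => bool_irrelevance _ _) (fun _ _ _ => bool_irrelevance _ _)
    (fun _ _ _ _ _ _ _ => bool_irrelevance _ _).

End PosetCategory.

Section NatTransTheory.
Variables (C D : category).

Lemma nat_transP (F G : functor C D) (a b : nat_trans F G) :
  (forall x, a x = b x) -> a = b.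
Proof.
case: a b => a na [b nb] /= E; have {}E : a = b by apply: functional_extensionality_dep.
by case: b / E nb => nb; congr NatTrans; apply: Prop_irrelevance.
Qed.

Lemma nat_transE (F G : functor C D) (a b : nat_trans F G) :
  a = b -> forall x, a x = b x.
Proof. by move->. Qed.

Fact nat_id_natural (F : functor C D) x y (f : hom x y) :
  idm (F y) \mo fmap F f = fmap F f \mo idm (F x).
Proof. by rewrite comp1m compm1. Qed.

Definition nat_id (F : functor C D) : nat_trans F F :=
  @NatTrans C D F F (fun x => idm (F x)) (nat_id_natural F).

Fact nat_comp_natural (F G H : functor C D) (b : nat_trans G H)
    (a : nat_trans F G) x y (f : hom x y) :
  (b y \mo a y) \mo fmap F f = fmap H f \mo (b x \mo a x).
Proof. by rewrite -compA nt_natural compA nt_natural compA. Qed.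

Definition nat_comp (F G H : functor C D) (b : nat_trans G H)
    (a : nat_trans F G) : nat_trans F H :=
  @NatTrans C D F H (fun x => b x \mo a x) (nat_comp_natural b a).

Definition functor_cat : category.
Proof.
refine (@Category (functor C D) (@nat_trans C D) nat_id nat_comp _ _ _).
- by move=> F G a; apply: nat_transP => x; apply: comp1m.
- by move=> F G a; apply: nat_transP => x; apply: compm1.
- by move=> F G H K c b a; apply: nat_transP => x; apply: compA.
Defined.

End NatTransTheory.

Section DiagramCategory.
Variables (C : category) (A : abelian).

Section Zmod.
Variables F G : functor C A.

HB.instance Definition _ := gen_eqMixin (nat_trans F G).
HB.instance Definition _ := gen_choiceMixin (nat_trans F G).

Fact nat_zero_natural x y (f : hom x y) :
  (0 : hom (F y) (G y)) \mo fmap F f = fmap G f \mo (0 : hom (F x) (G x)).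
Proof. by rewrite comp0m compm0. Qed.

Fact nat_opp_natural (a : nat_trans F G) x y (f : hom x y) :
  (- a y) \mo fmap F f = fmap G f \mo (- a x).
Proof. by rewrite compNm compmN nt_natural. Qed.

Fact nat_add_natural (a b : nat_trans F G) x y (f : hom x y) :
  (a y + b y) \mo fmap F f = fmap G f \mo (a x + b x).
Proof. by rewrite compDl compDr !nt_natural. Qed.

Definition nat_zero : nat_trans F G := NatTrans nat_zero_natural.
Definition nat_opp a : nat_trans F G := NatTrans (nat_opp_natural a).
Definition nat_add a b : nat_trans F G := NatTrans (nat_add_natural a b).

Fact nat_addA : associative nat_add.
Proof. by move=> a b c; apply: nat_transP => x; apply: addrA. Qed.
Fact nat_addC : commutative nat_add.
Proof. by move=> a b; apply: nat_transP => x; apply: addrC. Qed.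
Fact nat_add0 : left_id nat_zero nat_add.
Proof. by move=> a; apply: nat_transP => x; apply: add0r. Qed.
Fact nat_addN : left_inverse nat_zero nat_opp nat_add.
Proof. by move=> a; apply: nat_transP => x; apply: addNr. Qed.

HB.instance Definition _ :=
  GRing.isZmodule.Build (nat_trans F G) nat_addA nat_addC nat_add0 nat_addN.
End Zmod.

Definition diagram_zcat : zcategory :=
  @ZCategory (functor_cat C A)
    (fun F G => GRing.Zmodule.class (nat_trans F G : zmodType)).

Definition diagram_zero : functor C A :=
  @Functor C A (fun _ => zob A) (fun _ _ _ => idm _)
    (fun _ => erefl) (fun _ _ _ _ _ => esym (comp1m _)).

Section Biproduct.
Variables F G : functor C A.

Let bmap x y (f : hom x y) : hom (bip (F x) (G x)) (bip (F y) (G y)) :=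
  in1 _ _ \mo fmap F f \mo pr1 _ _ + in2 _ _ \mo fmap G f \mo pr2 _ _.

Let bmap_in1 x y (f : hom x y) : bmap f \mo in1 _ _ = in1 _ _ \mo fmap F f.
Proof. by rewrite compDl -!compA pr1_in1 pr2_in1 !compm0 addr0 compm1. Qed.

Let bmap_in2 x y (f : hom x y) : bmap f \mo in2 _ _ = in2 _ _ \mo fmap G f.
Proof. by rewrite compDl -!compA pr1_in2 pr2_in2 !compm0 add0r compm1. Qed.

Let pr1_bmap x y (f : hom x y) : pr1 _ _ \mo bmap f = fmap F f \mo pr1 _ _.
Proof. by rewrite compDr !compA pr1_in1 pr1_in2 !comp0m addr0 comp1m. Qed.

Let pr2_bmap x y (f : hom x y) : pr2 _ _ \mo bmap f = fmap G f \mo pr2 _ _.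
Proof. by rewrite compDr !compA pr2_in1 pr2_in2 !comp0m add0r comp1m. Qed.

Fact diagram_bip_id x : bmap (idm x) = idm _.
Proof. by rewrite /bmap !fmap_id !compm1 bip_id. Qed.

Fact diagram_bip_comp x y z (g : hom y z) (f : hom x y) :
  bmap (g \mo f) = bmap g \mo bmap f.
Proof.
by rewrite [bmap f]/bmap compDr !compA bmap_in1 bmap_in2 -!(compA _ (fmap _ g))
  -!fmap_comp.
Qed.

Definition diagram_bip : functor C A :=
  @Functor C A (fun x => bip (F x) (G x)) bmap diagram_bip_id diagram_bip_comp.

Definition diagram_in1 : nat_trans F diagram_bip :=
  @NatTrans C A F diagram_bip (fun x => in1 (F x) (G x))
    (fun x y f => esym (bmap_in1 f)).
Definition diagram_in2 : nat_trans G diagram_bip :=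
  @NatTrans C A G diagram_bip (fun x => in2 (F x) (G x))
    (fun x y f => esym (bmap_in2 f)).
Definition diagram_pr1 : nat_trans diagram_bip F :=
  @NatTrans C A diagram_bip F (fun x => pr1 (F x) (G x)) pr1_bmap.
Definition diagram_pr2 : nat_trans diagram_bip G :=
  @NatTrans C A diagram_bip G (fun x => pr2 (F x) (G x)) pr2_bmap.
End Biproduct.

Section KernelCokernel.
Variables (F G : functor C A) (a : nat_trans F G).

Fact diagram_ker_subproof x y (f : hom x y) :
  a y \mo (fmap F f \mo kerm (a x)) = 0.
Proof. by rewrite compA nt_natural -compA comp_kerm compm0. Qed.

Let kmap x y (f : hom x y) : hom (ker (a x)) (ker (a y)) :=
  ker_lift (diagram_ker_subproof f).

Let kmapE x y (f : hom x y) : kerm (a y) \mo kmap f = fmap F f \mo kerm (a x).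
Proof. exact: ker_liftE. Qed.

Fact diagram_ker_id x : kmap (idm x) = idm _.
Proof. by apply: (@kerm_mono A); rewrite kmapE fmap_id comp1m compm1. Qed.

Fact diagram_ker_comp x y z (g : hom y z) (f : hom x y) :
  kmap (g \mo f) = kmap g \mo kmap f.
Proof.
by apply: (@kerm_mono A); rewrite compA !kmapE -compA kmapE compA fmap_comp.
Qed.

Definition diagram_ker : functor C A :=
  @Functor C A (fun x => ker (a x)) kmap diagram_ker_id diagram_ker_comp.

Definition diagram_kerm : nat_trans diagram_ker F :=
  @NatTrans C A diagram_ker F (fun x => kerm (a x)) kmapE.

Fact diagram_coker_subproof x y (f : hom x y) :
  (cokerm (a y) \mo fmap G f) \mo a x = 0.
Proof. by rewrite -compA -nt_natural compA cokerm_comp comp0m. Qed.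

Let cmap x y (f : hom x y) : hom (coker (a x)) (coker (a y)) :=
  coker_desc (diagram_coker_subproof f).

Let cmapE x y (f : hom x y) :
  cmap f \mo cokerm (a x) = cokerm (a y) \mo fmap G f.
Proof. exact: coker_descE. Qed.

Fact diagram_coker_id x : cmap (idm x) = idm _.
Proof. by apply: (@cokerm_epi A); rewrite cmapE fmap_id comp1m compm1. Qed.

Fact diagram_coker_comp x y z (g : hom y z) (f : hom x y) :
  cmap (g \mo f) = cmap g \mo cmap f.
Proof.
by apply: (@cokerm_epi A); rewrite -compA !cmapE compA cmapE -compA fmap_comp.
Qed.

Definition diagram_coker : functor C A :=
  @Functor C A (fun x => coker (a x)) cmap diagram_coker_id diagram_coker_comp.

Definition diagram_cokerm : nat_trans G diagram_coker :=
  @NatTrans C A G diagram_coker (fun x => cokerm (a x)) (fun x y f => esym (cmapE f)).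
End KernelCokernel.

Implicit Types F G H K : diagram_zcat.

Fact nat_kernel F G K (a : hom F G) (i : hom K F) :
  (forall x, is_kernel (ntc a x) (ntc i x)) -> is_kernel a i.
Proof.
move=> ki; split; first by apply: nat_transP => x; apply: (ki x).1.
move=> W g E.
have Ex x : ntc a x \mo ntc g x = 0 by exact: nat_transE E x.
pose h x := projT1 (cid ((ki x).2 _ _ (Ex x))).
have hE x : ntc i x \mo h x = ntc g x by rewrite /h; case: cid => ? [].
have imono x w (u v : hom w (K x)) : ntc i x \mo u = ntc i x \mo v -> u = v.
  move=> uv; have E0 : ntc a x \mo (ntc i x \mo u) = 0.
    by rewrite compA (ki x).1 comp0m.
  by have [k [_ ku]] := (ki x).2 _ _ E0; rewrite -(ku u erefl) -(ku v (esym uv)).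
have hn x y (f : hom x y) : h y \mo fmap W f = fmap K f \mo h x.
  by apply: imono; rewrite !compA hE !nt_natural -compA hE.
exists (NatTrans hn); split; first by apply: nat_transP => x; apply: hE.
move=> h' E'; apply: nat_transP => x; apply: imono; rewrite hE.
by exact: esym (nat_transE E' x).
Qed.

Fact nat_cokernel F G K (a : hom F G) (q : hom G K) :
  (forall x, is_cokernel (ntc a x) (ntc q x)) -> is_cokernel a q.
Proof.
move=> kq; split; first by apply: nat_transP => x; apply: (kq x).1.
move=> W g E.
have Ex x : ntc g x \mo ntc a x = 0 by exact: nat_transE E x.
pose h x := projT1 (cid ((kq x).2 _ _ (Ex x))).
have hE x : h x \mo ntc q x = ntc g x by rewrite /h; case: cid => ? [].
have qepi x w (u v : hom (K x) w) : u \mo ntc q x = v \mo ntc q x -> u = v.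
  move=> uv; have E0 : (u \mo ntc q x) \mo ntc a x = 0.
    by rewrite -compA (kq x).1 compm0.
  by have [k [_ ku]] := (kq x).2 _ _ E0; rewrite -(ku u erefl) -(ku v (esym uv)).
have hn x y (f : hom x y) : h y \mo fmap K f = fmap W f \mo h x.
  by apply: qepi; rewrite -!compA hE -!nt_natural compA hE.
exists (NatTrans hn); split; first by apply: nat_transP => x; apply: hE.
move=> h' E'; apply: nat_transP => x; apply: qepi; rewrite hE.
by exact: esym (nat_transE E' x).
Qed.

Fact nat_mono F G (a : hom F G) : mono a -> forall x, mono (ntc a x).
Proof.
move=> ma x w g h E.
have k0 : (diagram_kerm a : hom (diagram_ker a : diagram_zcat) F) = 0.
  apply: ma; apply: nat_transP => y /=.
  by rewrite comp_kerm [RHS]compm0.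
have kx0 : kerm (ntc a x) = 0.
  exact: nat_transE k0 x.
have E0 : ntc a x \mo (g - h) = 0 by rewrite compDr compmN E subrr.
by apply/subr0_eq; rewrite -(ker_liftE E0) kx0 comp0m.
Qed.

Fact nat_epi F G (a : hom F G) : epi a -> forall x, epi (ntc a x).
Proof.
move=> ea x w g h E.
have k0 : (diagram_cokerm a : hom G (diagram_coker a : diagram_zcat)) = 0.
  apply: ea; apply: nat_transP => y /=.
  by rewrite cokerm_comp [RHS]comp0m.
have kx0 : cokerm (ntc a x) = 0.
  exact: nat_transE k0 x.
have E0 : (g - h) \mo ntc a x = 0 by rewrite compDl compNm E subrr.
by apply/subr0_eq; rewrite -(coker_descE E0) kx0 compm0.
Qed.

Definition diagram_cat : abelian.
Proof.
refine (@Abelian diagram_zcat _ _ diagram_zero _ _ diagram_bip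
  diagram_in1 diagram_in2 diagram_pr1 diagram_pr2 _ _ _ _ _
  diagram_ker diagram_kerm _ diagram_coker diagram_cokerm _ _ _).
- by move=> F G H g g' f; apply: nat_transP => x; apply: compDl.
- by move=> F G H g f f'; apply: nat_transP => x; apply: compDr.
- by move=> F f; apply: nat_transP => x; apply: zob_term.
- by move=> F f; apply: nat_transP => x; apply: zob_init.
- by move=> F G; apply: nat_transP => x; apply: pr1_in1.
- by move=> F G; apply: nat_transP => x; apply: pr2_in2.
- by move=> F G; apply: nat_transP => x; apply: pr1_in2.
- by move=> F G; apply: nat_transP => x; apply: pr2_in1.
- by move=> F G; apply: nat_transP => x; apply: bip_id.
- by move=> F G a; apply: nat_kernel => x; apply: kermP.
- by move=> F G a; apply: nat_cokernel => x; apply: cokermP.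
- move=> F G a ma; apply: nat_kernel => x.
  exact/mono_normal/nat_mono.
- move=> F G a ea; apply: nat_cokernel => x.
  exact/epi_normal/nat_epi.
Defined.

End DiagramCategory.

Section Localization.
Variables (C : category) (W : forall x y : C, hom x y -> Prop).

Inductive loc_word : C -> C -> Type :=
| LocMap x y (f : hom x y) : loc_word x y
| LocInv x y (w : hom x y) (Ww : W w) : loc_word y x
| LocComp x y z (v : loc_word y z) (u : loc_word x y) : loc_word x z.

Inductive loc_eq : forall x y, loc_word x y -> loc_word x y -> Prop :=
| loc_refl x y (u : loc_word x y) : loc_eq u u
| loc_sym x y (u v : loc_word x y) : loc_eq u v -> loc_eq v u
| loc_trans x y (u v w : loc_word x y) : loc_eq u v -> loc_eq v w -> loc_eq u w
| loc_congr x y z (v v' : loc_word y z) (u u' : loc_word x y) :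
    loc_eq v v' -> loc_eq u u' -> loc_eq (LocComp v u) (LocComp v' u')
| loc_assoc x y z t (w : loc_word z t) (v : loc_word y z) (u : loc_word x y) :
    loc_eq (LocComp w (LocComp v u)) (LocComp (LocComp w v) u)
| loc_idl x y (u : loc_word x y) : loc_eq (LocComp (LocMap (idm y)) u) u
| loc_idr x y (u : loc_word x y) : loc_eq (LocComp u (LocMap (idm x))) u
| loc_mapM x y z (g : hom y z) (f : hom x y) :
    loc_eq (LocMap (g \mo f)) (LocComp (LocMap g) (LocMap f))
| loc_invK x y (w : hom x y) (Ww : W w) :
    loc_eq (LocComp (LocInv Ww) (LocMap w)) (LocMap (idm x))
| loc_Kinv x y (w : hom x y) (Ww : W w) :
    loc_eq (LocComp (LocMap w) (LocInv Ww)) (LocMap (idm y)).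

(* Morphisms of the localization are the equivalence classes of words. *)
Definition loc_hom (x y : C) : Type :=
  {S : loc_word x y -> Prop | exists u, S = loc_eq u}.

Definition loc_class x y (u : loc_word x y) : loc_hom x y :=
  exist _ (loc_eq u) (ex_intro _ u erefl).

Definition loc_repr x y (S : loc_hom x y) : loc_word x y :=
  projT1 (cid (proj2_sig S)).

Lemma loc_reprK x y (S : loc_hom x y) : loc_class (loc_repr S) = S.
Proof.
rewrite /loc_repr; case: cid => u /=; case: S => S SP /= E.
by apply: eq_exist; rewrite E.
Qed.

Lemma loc_class_eq x y (u v : loc_word x y) :
  loc_class u = loc_class v <-> loc_eq u v.
Proof.
split=> [E|uv].
  have /= {}E : loc_eq u = loc_eq v := congr1 (@proj1_sig _ _) E.
  by rewrite E; apply: loc_refl.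
apply: eq_exist; apply: funext => w; apply: propext.
by split; apply: loc_trans => //; apply: loc_sym.
Qed.

Lemma loc_repr_class x y (u : loc_word x y) : loc_eq (loc_repr (loc_class u)) u.
Proof. by apply/loc_class_eq; rewrite loc_reprK. Qed.

Definition loc_comp x y z (S : loc_hom y z) (T : loc_hom x y) : loc_hom x z :=
  loc_class (LocComp (loc_repr S) (loc_repr T)).

Lemma loc_compE x y z (v : loc_word y z) (u : loc_word x y) :
  loc_comp (loc_class v) (loc_class u) = loc_class (LocComp v u).
Proof. by apply/loc_class_eq/loc_congr; apply: loc_repr_class. Qed.

Definition localization : category.
Proof.
refine (@Category C loc_hom (fun x => loc_class (LocMap (idm x))) loc_comp _ _ _).
- move=> x y S; rewrite -[S in LHS]loc_reprK loc_compE -[RHS]loc_reprK.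
  exact/loc_class_eq/loc_idl.
- move=> x y S; rewrite -[S in LHS]loc_reprK loc_compE -[RHS]loc_reprK.
  exact/loc_class_eq/loc_idr.
- move=> x y z t S T U; rewrite -(loc_reprK S) -(loc_reprK T) -(loc_reprK U).
  by rewrite !loc_compE; apply/loc_class_eq/loc_assoc.
Defined.

Definition loc_functor : functor C localization.
Proof.
refine (@Functor C localization id (fun x y f => loc_class (LocMap f)) _ _) => //.
by move=> x y z g f; rewrite [RHS]loc_compE; apply/loc_class_eq/loc_mapM.
Defined.

End Localization.

Section LocalizedFunctor.
Variables (C D : category).
Variables (W : forall x y : C, hom x y -> Prop).
Variables (V : forall x y : D, hom x y -> Prop).
Variables (F : functor C D).
Hypothesis FW : forall x y (f : hom x y), W f -> V (fmap F f).

Fixpoint loc_word_map x y (u : loc_word W x y) : loc_word V (F x) (F y) :=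
  match u in loc_word _ x y return loc_word V (F x) (F y) with
  | LocMap _ _ f => LocMap V (fmap F f)
  | LocInv _ _ _ Ww => LocInv (FW Ww)
  | LocComp _ _ _ v u => LocComp (loc_word_map v) (loc_word_map u)
  end.

Lemma loc_word_map_eq x y (u v : loc_word W x y) :
  loc_eq u v -> loc_eq (loc_word_map u) (loc_word_map v).
Proof.
elim=> {x y u v} /=; rewrite ?fmap_id.
- by move=> *; apply: loc_refl.
- by move=> *; apply: loc_sym.
- by move=> x y u v w _ uv _; apply: loc_trans.
- by move=> *; apply: loc_congr.
- by move=> *; apply: loc_assoc.
- by move=> x y u; rewrite fmap_id; apply: loc_idl.
- by move=> x y u; rewrite fmap_id; apply: loc_idr.
- by move=> x y z g f; rewrite fmap_comp; apply: loc_mapM.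
- by move=> x y w Ww; rewrite fmap_id; apply: loc_invK.
- by move=> x y w Ww; rewrite fmap_id; apply: loc_Kinv.
Qed.

Definition localized_functor : functor (localization W) (localization V).
Proof.
refine (@Functor (localization W) (localization V) (fun x => F x)
  (fun x y S => loc_class (loc_word_map (loc_repr S))) _ _).
- move=> x; apply/loc_class_eq.
  apply: loc_trans (loc_word_map_eq (loc_repr_class _)) _.
  by rewrite /= fmap_id; apply: loc_refl.
- move=> x y z S T; rewrite [RHS]loc_compE; apply/loc_class_eq.
  exact: loc_trans (loc_word_map_eq (loc_repr_class _)) (loc_refl _).
Defined.

End LocalizedFunctor.

Definition succz (n : int) : int := n + 1.

Section Complexes.
Variable A : abelian.

Record complex : Type := Complex {
  cx :> int -> A;
  diff : forall n, hom (cx n) (cx (succz n));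
  diffK : forall n, diff (succz n) \mo diff n = 0 }.

Record chain_map (X Y : complex) : Type := ChainMap {
  cm :> forall n, hom (X n) (Y n);
  cm_diff : forall n, cm (succz n) \mo diff X n = diff Y n \mo cm n }.

Lemma chain_mapP (X Y : complex) (f g : chain_map X Y) :
  (forall n, f n = g n) -> f = g.
Proof.
case: f g => f fd [g gd] /= E.
have {}E : f = g by apply: functional_extensionality_dep.
by case: g / E gd => gd; congr ChainMap; apply: Prop_irrelevance.
Qed.

Fact chain_id_diff (X : complex) n :
  idm (X (succz n)) \mo diff X n = diff X n \mo idm (X n).
Proof. by rewrite comp1m compm1. Qed.

Definition chain_id (X : complex) : chain_map X X := ChainMap (@chain_id_diff X).

Fact chain_comp_diff (X Y Z : complex) (g : chain_map Y Z) (f : chain_map X Y) n :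
  (g (succz n) \mo f (succz n)) \mo diff X n = diff Z n \mo (g n \mo f n).
Proof. by rewrite -compA cm_diff compA cm_diff compA. Qed.

Definition chain_comp (X Y Z : complex) (g : chain_map Y Z) (f : chain_map X Y) :
  chain_map X Z := ChainMap (chain_comp_diff g f).

Definition complex_cat : category.
Proof.
refine (@Category complex chain_map chain_id chain_comp _ _ _).
- by move=> X Y f; apply: chain_mapP => n; apply: comp1m.
- by move=> X Y f; apply: chain_mapP => n; apply: compm1.
- by move=> X Y Z T h g f; apply: chain_mapP => n; apply: compA.
Defined.

Definition boundary (X : complex) (n : int) : hom (X n) (ker (diff X (succz n))) :=
  ker_lift (diffK X n).

(* [homology X n] is the cohomology of [X] in degree [succz n], namely the
   cokernel of the map [X n -> ker (X (n + 1) -> X (n + 2))].  Since [n]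
   ranges over [int], all degrees are covered. *)
Definition homology (X : complex) (n : int) : A := coker (boundary X n).

Section HomologyMap.
Variables (X Y : complex) (f : chain_map X Y) (n : int).

Fact cycle_map_subproof :
  diff Y (succz n) \mo (f (succz n) \mo kerm (diff X (succz n))) = 0.
Proof. by rewrite compA -cm_diff -compA comp_kerm compm0. Qed.

Definition cycle_map : hom (ker (diff X (succz n))) (ker (diff Y (succz n))) :=
  ker_lift cycle_map_subproof.

Lemma cycle_map_boundary : cycle_map \mo boundary X n = boundary Y n \mo f n.
Proof. by apply: kerm_mono; rewrite !compA !ker_liftE -compA ker_liftE cm_diff. Qed.

Fact homology_map_subproof : (cokerm (boundary Y n) \mo cycle_map) \mo boundary X n = 0.
Proof. by rewrite -compA cycle_map_boundary compA cokerm_comp comp0m. Qed.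

Definition homology_map : hom (homology X n) (homology Y n) :=
  coker_desc homology_map_subproof.
End HomologyMap.

Definition quasi_iso (X Y : complex_cat) (f : hom X Y) : Prop :=
  forall n, is_iso (homology_map f n).

(* The sign of the differential of [X[1]] and the differential
   [(x, y) |-> (- d x, f x + d y)] of the cone follow Gelfand and Manin. *)
Definition shift_ob (X : complex) : complex.
Proof.
refine (@Complex (fun n => X (succz n)) (fun n => - diff X (succz n)) _).
by move=> n; rewrite compNm compmN opprK diffK.
Defined.

Definition shift_map (X Y : complex) (f : chain_map X Y) :
  chain_map (shift_ob X) (shift_ob Y).
Proof.
refine (@ChainMap (shift_ob X) (shift_ob Y) (fun n => f (succz n)) _).
by move=> n /=; rewrite compmN compNm cm_diff.
Defined.

Definition complex_shift : functor complex_cat complex_cat.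
Proof.
refine (@Functor complex_cat complex_cat shift_ob shift_map _ _).
- by move=> X; apply: chain_mapP.
- by move=> X Y Z g f; apply: chain_mapP.
Defined.

Section Cone.
Variables (X Y : complex) (f : chain_map X Y).

Definition cone_diff (n : int) :
    hom (bip (X (succz n)) (Y n)) (bip (X (succz (succz n))) (Y (succz n))) :=
  in1 _ _ \mo (- diff X (succz n) \mo pr1 _ _) +
  in2 _ _ \mo (f (succz n) \mo pr1 _ _ + diff Y n \mo pr2 _ _).

Lemma pr1_cone_diff n : pr1 _ _ \mo cone_diff n = - diff X (succz n) \mo pr1 _ _.
Proof. by rewrite compDr !compA pr1_in1 pr1_in2 !comp0m addr0 comp1m. Qed.

Lemma pr2_cone_diff n :
  pr2 _ _ \mo cone_diff n = f (succz n) \mo pr1 _ _ + diff Y n \mo pr2 _ _.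
Proof. by rewrite compDr !(compA (pr2 _ _)) pr2_in1 pr2_in2 !comp0m add0r comp1m. Qed.

Lemma cone_diff_in2 n : cone_diff n \mo in2 _ _ = in2 _ _ \mo diff Y n.
Proof.
by rewrite compDl -!compA compDl -!compA pr1_in2 pr2_in2 !compm0 !add0r compm1.
Qed.

Definition cone : complex.
Proof.
refine (@Complex (fun n => bip (X (succz n)) (Y n)) cone_diff _) => n.
have dX : diff X (succz (succz n)) \mo (- diff X (succz n)) = 0.
  by rewrite compmN diffK oppr0.
rewrite {1}/cone_diff compDl -!compA compDl -!compA pr1_cone_diff pr2_cone_diff.
rewrite compNm (compA (diff X _)) dX comp0m oppr0 compm0 add0r.
rewrite (compDr (diff Y _)) !(compA (diff Y _)) diffK comp0m addr0 -cm_diff.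
by rewrite -compA compNm compmN addNr compm0.
Defined.

Definition cone_in : chain_map Y cone.
Proof.
refine (@ChainMap Y cone (fun n => in2 _ _) _) => n.
exact/esym/cone_diff_in2.
Defined.

Definition cone_pr : chain_map cone (shift_ob X).
Proof.
refine (@ChainMap cone (shift_ob X) (fun n => pr1 _ _) _) => n.
exact: pr1_cone_diff.
Defined.
End Cone.

End Complexes.

Section ShiftQuasiIso.
Variable A : abelian.
Implicit Types X Y : complex A.

Section Homology.
Variables (X : complex A) (n : int).
Let m := succz n.
Let k := kerm (diff X (succz m)).
Let k' := kerm (diff (shift_ob X) m).

Fact shift_cycle_subproof : diff (shift_ob X) m \mo k = 0.
Proof. by rewrite /= compNm comp_kerm oppr0. Qed.

Fact unshift_cycle_subproof : diff X (succz m) \mo k' = 0.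
Proof. by apply: oppr_inj; rewrite -compNm oppr0; apply: comp_kerm. Qed.

Let u := ker_lift shift_cycle_subproof.
Let v := ker_lift unshift_cycle_subproof.

Let uE : k' \mo u = k. Proof. exact: ker_liftE. Qed.
Let vE : k \mo v = k'. Proof. exact: ker_liftE. Qed.

Let uv : u \mo v = idm _.
Proof. by apply: kerm_mono; rewrite compA uE vE compm1. Qed.

Let vu : v \mo u = idm _.
Proof. by apply: kerm_mono; rewrite compA vE uE compm1. Qed.

Let u_boundary : u \mo boundary X m = - boundary (shift_ob X) n.
Proof.
apply: kerm_mono; rewrite compA [in LHS]uE compmN ker_liftE.
by apply: oppr_inj; rewrite opprK ker_liftE.
Qed.

Let v_boundary : v \mo boundary (shift_ob X) n = - boundary X m.
Proof. by rewrite -[boundary (shift_ob X) n]opprK -u_boundary compmN compA vu comp1m. Qed.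

Lemma homology_shift :
  exists (a : hom (homology X m) (homology (shift_ob X) n))
         (b : hom (homology (shift_ob X) n) (homology X m)),
    [/\ b \mo a = idm _, a \mo b = idm _ &
        a \mo cokerm (boundary X m) = cokerm (boundary (shift_ob X) n) \mo u].
Proof.
have E1 : (cokerm (boundary (shift_ob X) n) \mo u) \mo boundary X m = 0.
  by rewrite -compA u_boundary compmN cokerm_comp oppr0.
have E2 : (cokerm (boundary X m) \mo v) \mo boundary (shift_ob X) n = 0.
  by rewrite -compA v_boundary compmN cokerm_comp oppr0.
exists (coker_desc E1), (coker_desc E2); split; last exact: coker_descE.
- apply: cokerm_epi; rewrite -compA coker_descE compA coker_descE -compA vu.
  by rewrite compm1 comp1m.
- apply: cokerm_epi; rewrite -compA coker_descE compA coker_descE -compA uv.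
  by rewrite compm1 comp1m.
Qed.
End Homology.

Lemma quasi_iso_shift (X Y : complex_cat A) (f : hom X Y) :
  quasi_iso f -> quasi_iso (fmap (complex_shift A) f).
Proof.
move=> qf n; have [g [gf fg]] := qf (succz n).
have [a [b [ba ab aE]]] := homology_shift X n.
have [a' [b' [ba' ab' aE']]] := homology_shift Y n.
have nat : homology_map (shift_map f) n \mo a = a' \mo homology_map f (succz n).
  apply: cokerm_epi; rewrite -!compA aE [in LHS]compA !coker_descE.
  rewrite (compA a') aE' -!compA; congr (_ \mo _).
  by apply: kerm_mono; rewrite !compA !ker_liftE -!compA !ker_liftE.
have {}nat : homology_map (shift_map f) n = a' \mo homology_map f (succz n) \mo b.
  by rewrite -nat -compA ab compm1.
exists (a \mo g \mo b'); split; rewrite [homology_map _ _]nat.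
- by rewrite -!compA (compA b') ba' comp1m (compA g) gf comp1m ab.
- by rewrite -!compA (compA b) ba comp1m (compA _ g) fg comp1m ab'.
Qed.

End ShiftQuasiIso.

(* The data relative to which triangle functors are defined; the axioms of
   triangulated categories are not part of it. *)
Record tri_category : Type := TriCategory {
  tcat :> category;
  shift : functor tcat tcat;
  triangle : forall x y z : tcat,
    hom x y -> hom y z -> hom z (shift x) -> Prop }.

Arguments shift {t}.

(* A triangle equivalence is an equivalence [F] with a natural isomorphism
   [F (x[1]) -> (F x)[1]] through which [F] preserves distinguished triangles.
   Additivity of [F] need not be required: an equivalence between additive
   categories preserves biproducts. *)
Definition tri_equivalent (S T : tri_category) : Prop :=
  exists (F : functor S T)
         (phi : nat_trans (functor_comp F shift) (functor_comp shift F)),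
    [/\ is_equivalence F,
        is_nat_iso phi &
        forall (x y z : S) (u : hom x y) (v : hom y z) (w : hom z (shift x)),
          triangle u v w -> triangle (fmap F u) (fmap F v) (phi x \mo fmap F w)].

Section DerivedCategory.
Variable A : abelian.

(* The unbounded derived category, as in Gelfand and Manin: the localization of
   the category of all cochain complexes at the quasi-isomorphisms.  Homotopic
   maps become equal in it, so the homotopy category is not needed. *)
Definition derived_category : category := localization (@quasi_iso A).

Definition to_derived : functor (complex_cat A) derived_category :=
  loc_functor (@quasi_iso A).

Definition derived_shift : functor derived_category derived_category :=
  localized_functor (@quasi_iso_shift A).

(* [to_derived] commutes with the shifts on the nose on objects, so the image
   of [cone_pr f] is a morphism to [derived_shift X]. *)
Definition derived_triangle (x y z : derived_category)
    (u : hom x y) (v : hom y z) (w : hom z (derived_shift x)) : Prop :=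
  exists (X Y : complex_cat A) (f : hom X Y)
         (a : hom x (to_derived X)) (b : hom y (to_derived Y))
         (c : hom z (to_derived (cone f))),
    [/\ is_iso a, is_iso b & is_iso c] /\
    [/\ b \mo u = fmap to_derived f \mo a,
        c \mo v = fmap to_derived (cone_in f : hom (Y : complex_cat A) (cone f)) \mo b &
        fmap derived_shift a \mo w =
        fmap to_derived (cone_pr f : hom (cone f : complex_cat A) (shift_ob X)) \mo c].

Definition derived : tri_category :=
  @TriCategory derived_category derived_shift derived_triangle.

End DerivedCategory.

Definition universally_derived_equivalent (d1 d2 : Order.disp_t)
    (P : porderType d1) (Q : porderType d2) : Prop :=
  forall A : abelian,
    tri_equivalent (derived (diagram_cat (poset_cat P) A))
                   (derived (diagram_cat (poset_cat Q) A)).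

(* Main.v *)
(* Write [*] for the one-element poset.  A diagram [K] on X + * + Z (ordinal sum)
   is sent to the diagram [Phi K] on * + (X + Z) which agrees with [K] on [*] and
   [Z] and is the cone of [K x -> K *] at a point [x] of [X].  Conversely, a diagram
   [L] on * + (X + Z) is sent to the diagram [Phi' L] given by the shift of [L] on
   [*] and [Z] and by the cone of [L * -> L x] at [x].  Both constructions are cones
   of natural transformations between exact functors, U -> V and U' -> V', so that
   they preserve quasi-isomorphisms, shifts and triangles.  Since U'U and VV' vanish,
   [Phi' Phi K] is, up to shift, the total complex of U'V K + V'U K -> V'V K, which is
   part of a bicartesian square with corner [K]; whence a natural quasi-isomorphism
   K[1] -> Phi' Phi K, and dually Phi Phi' L -> L[1].  As the shift is an
   equivalence, so are [Phi] and [Phi'].  The second equivalence follows from the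
   first one and the isomorphism X + Z = Z + X of direct sums. *)
From mathcomp Require Import all_boot all_order all_algebra.
From mathcomp Require Import boolp.
Require Import Defs.

Set Implicit Arguments.
Unset Strict Implicit.
Unset Printing Implicit Defensive.

Import Order.TTheory GRing.Theory.
Local Open Scope ring_scope.
Local Open Scope cat_scope.

(** * Equivalences and localizations *)

(** The obstacle is that morphisms of the derived category are classes of words, with which one can
    hardly compute. Every map is therefore built on complexes; in the localization only naturality
    is checked, letter by letter, and a transformation whose components are quasi-isomorphisms
    becomes an isomorphism there. Quasi-isomorphism is traded for acyclicity of the cone, because
    forming cones commutes with the cone functors up to isomorphism, and because acyclicity can be
    chased on generalized elements whose domain is refined by epimorphisms.

    [tri_equivalent] is not visibly symmetric: a quasi-inverse need not obviously respect triangles.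
    Hence both cone functors are shown to be triangle equivalences, and both directions are
    recorded.

    The four exact functors restrict a diagram along a monotone map defined on part of a poset and
    put zero elsewhere. The vanishing conditions and the bicartesian squares thus become statements
    about composites of partial maps, settled by cases: at each point one pair of opposite sides of
    the square is invertible. *)

Section Isomorphisms.
Variable C : category.

Lemma is_iso_id (x : C) : is_iso (idm x).
Proof. by exists (idm x); rewrite comp1m. Qed.

Lemma is_iso_comp (x y z : C) (g : hom y z) (f : hom x y) :
  is_iso g -> is_iso f -> is_iso (g \mo f).
Proof.
move=> [g' [gl gr]] [f' [fl fr]]; exists (f' \mo g'); split.
- by rewrite -compA (compA g') gl comp1m.
- by rewrite -compA (compA f) fr comp1m.
Qed.

Lemma is_iso_fmap (D : category) (F : functor C D) (x y : C) (f : hom x y) :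
  is_iso f -> is_iso (fmap F f).
Proof. by move=> [g [gl gr]]; exists (fmap F g); rewrite -!fmap_comp gl gr !fmap_id. Qed.

End Isomorphisms.

Definition nat_isomorphic (C D : category) (F G : functor C D) : Prop :=
  exists a : nat_trans F G, is_nat_iso a.

Section NatIsomorphic.
Variables C D E : category.

Lemma nat_isomorphic_trans (F G H : functor C D) :
  nat_isomorphic F G -> nat_isomorphic G H -> nat_isomorphic F H.
Proof.
by move=> [a ia] [b ib]; exists (nat_comp b a) => x; apply: is_iso_comp.
Qed.

Lemma nat_isomorphic_sym (F G : functor C D) :
  nat_isomorphic F G -> nat_isomorphic G F.
Proof.
move=> [a ia]; pose b x := projT1 (cid (ia x)).
have ba x : b x \mo a x = idm _ by rewrite /b; case: cid => g [].
have ab x : a x \mo b x = idm _ by rewrite /b; case: cid => g [].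
have nb x y (f : hom x y) : b y \mo fmap G f = fmap F f \mo b x.
  by rewrite -[LHS]compm1 -(ab x) -compA (compA (fmap G f)) -nt_natural -compA
    !compA ba comp1m.
by exists (NatTrans nb) => x; exists (a x).
Qed.

Lemma nat_isomorphic_compl (G : functor D E) (F F' : functor C D) :
  nat_isomorphic F F' -> nat_isomorphic (functor_comp G F) (functor_comp G F').
Proof.
move=> [a ia].
have n x y (f : hom x y) : fmap G (a y) \mo fmap (functor_comp G F) f =
    fmap (functor_comp G F') f \mo fmap G (a x).
  by rewrite /= -!fmap_comp nt_natural.
exists (@NatTrans _ _ (functor_comp G F) (functor_comp G F') _ n) => x.
exact: (is_iso_fmap G (ia x)).
Qed.

Lemma nat_isomorphic_compr (G G' : functor D E) (F : functor C D) :
  nat_isomorphic G G' -> nat_isomorphic (functor_comp G F) (functor_comp G' F).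
Proof.
move=> [a ia].
have n x y (f : hom x y) : a (F y) \mo fmap (functor_comp G F) f =
    fmap (functor_comp G' F) f \mo a (F x) by exact: (nt_natural a (fmap F f)).
exists (@NatTrans _ _ (functor_comp G F) (functor_comp G' F) _ n) => x.
exact: ia.
Qed.

End NatIsomorphic.

Section NatIsomorphicAssoc.
Variables B C D E : category.

Lemma nat_isomorphic_assoc (H : functor D E) (G : functor C D) (F : functor B C) :
  nat_isomorphic (functor_comp H (functor_comp G F))
                 (functor_comp (functor_comp H G) F).
Proof.
exists (@NatTrans _ _ (functor_comp H (functor_comp G F))
  (functor_comp (functor_comp H G) F) (fun x => idm _) (fun x y f =>
  etrans (comp1m _) (esym (compm1 _)))) => x.
exact: is_iso_id.
Qed.

Lemma nat_isomorphic_comp1 (F : functor B C) :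
  nat_isomorphic (functor_comp F (functor_id B)) F.
Proof.
exists (@NatTrans _ _ (functor_comp F (functor_id B)) F (fun x => idm _)
  (fun x y f => etrans (comp1m _) (esym (compm1 _)))) => x.
exact: is_iso_id.
Qed.

Lemma nat_isomorphic_1comp (F : functor B C) :
  nat_isomorphic (functor_comp (functor_id C) F) F.
Proof.
exists (@NatTrans _ _ (functor_comp (functor_id C) F) F (fun x => idm _)
  (fun x y f => etrans (comp1m _) (esym (compm1 _)))) => x.
exact: is_iso_id.
Qed.

End NatIsomorphicAssoc.

Lemma nat_isomorphic_cancel (B C D E : category) (G' : functor D E)
    (G : functor C D) (F : functor B C) (H : functor C E) (K : functor B E) :
  nat_isomorphic (functor_comp G' G) H -> nat_isomorphic (functor_comp H F) K ->
  nat_isomorphic (functor_comp G' (functor_comp G F)) K.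
Proof.
move=> G'G; apply: nat_isomorphic_trans.
apply: nat_isomorphic_trans (nat_isomorphic_assoc G' G F) _.
exact: nat_isomorphic_compr.
Qed.

Lemma nat_isomorphic_comp_inner (B C D E : category) (H : functor D E)
    (G : functor C D) (F : functor B C) (K : functor B D) (L : functor B E) :
  nat_isomorphic (functor_comp G F) K -> nat_isomorphic (functor_comp H K) L ->
  nat_isomorphic (functor_comp (functor_comp H G) F) L.
Proof.
move=> GF; apply: nat_isomorphic_trans.
apply: nat_isomorphic_trans (nat_isomorphic_sym (nat_isomorphic_assoc H G F)) _.
exact: nat_isomorphic_compl.
Qed.

Lemma is_equivalence_comp (C D E : category) (G : functor D E) (F : functor C D) :
  is_equivalence G -> is_equivalence F -> is_equivalence (functor_comp G F).
Proof.
move=> [G' [G'G GG']] [F' [F'F FF']]; exists (functor_comp F' G'); split.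
- apply: nat_isomorphic_comp_inner F'F.
  by apply: nat_isomorphic_cancel G'G _; apply: nat_isomorphic_1comp.
- apply: nat_isomorphic_comp_inner GG'.
  by apply: nat_isomorphic_cancel FF' _; apply: nat_isomorphic_1comp.
Qed.

(** The two one-sided inverses agree: [R] is isomorphic to [L F R], hence to [L]. *)
Lemma is_equivalence_lr (C D : category) (F : functor C D) (L R : functor D C) :
  nat_isomorphic (functor_comp L F) (functor_id C) ->
  nat_isomorphic (functor_comp F R) (functor_id D) -> is_equivalence F.
Proof.
move=> LF FR; exists R; split=> //.
have LR : nat_isomorphic R L.
  apply: nat_isomorphic_trans (nat_isomorphic_sym (nat_isomorphic_1comp R)) _.
  apply: nat_isomorphic_trans (nat_isomorphic_compr R (nat_isomorphic_sym LF)) _.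
  exact: nat_isomorphic_comp_inner FR (nat_isomorphic_comp1 L).
exact: nat_isomorphic_trans (nat_isomorphic_compr F LR) LF.
Qed.

Section EquivalenceUpTo.
Variables (C D : category) (F : functor C D) (G : functor D C).
Variables (S : functor C C) (T : functor D D).
Hypotheses (eS : is_equivalence S) (eT : is_equivalence T).
Hypotheses (GF : nat_isomorphic (functor_comp G F) S).
Hypotheses (FG : nat_isomorphic (functor_comp F G) T).

(** With quasi-inverses [S'] and [T'], the functor [S' G] is a left inverse of [F] and [G T'] a
    right one. This allows the composites of the two cone functors to be shifts instead of
    identities. *)
Lemma is_equivalence_up_to : is_equivalence F /\ is_equivalence G.
Proof.
have [S' [S'S SS']] := eS; have [T' [T'T TT']] := eT; split.
- apply: (@is_equivalence_lr _ _ F (functor_comp S' G) (functor_comp G T')).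
  + exact: nat_isomorphic_comp_inner GF S'S.
  + exact: nat_isomorphic_cancel FG TT'.
- apply: (@is_equivalence_lr _ _ G (functor_comp T' F) (functor_comp F S')).
  + exact: nat_isomorphic_comp_inner FG T'T.
  + exact: nat_isomorphic_cancel GF SS'.
Qed.
End EquivalenceUpTo.

Lemma tri_equivalent_trans (S T U : tri_category) :
  tri_equivalent S T -> tri_equivalent T U -> tri_equivalent S U.
Proof.
move=> [F [phi [eF iphi tF]]] [G [psi [eG ipsi tG]]].
have n (x y : S) (f : hom x y) :
    (psi (F y) \mo fmap G (phi y)) \mo fmap (functor_comp (functor_comp G F) shift) f =
    fmap (functor_comp shift (functor_comp G F)) f \mo (psi (F x) \mo fmap G (phi x)).
  rewrite -compA /= -fmap_comp (nt_natural phi f) /= fmap_comp compA.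
  by rewrite (nt_natural psi (fmap F f)) compA.
exists (functor_comp G F), (@NatTrans _ _ (functor_comp (functor_comp G F) shift)
  (functor_comp shift (functor_comp G F)) _ n); split.
- exact: is_equivalence_comp.
- move=> x; apply: is_iso_comp; first exact: ipsi.
  exact: (is_iso_fmap G (iphi x)).
- move=> x y z u v w /tF /tG.
  by rewrite /= fmap_comp compA.
Qed.

(** * Naturality on a localization *)

Section LocalizationTheory.
Variables (C : category) (W : forall x y : C, hom x y -> Prop).
Local Notation L := (loc_functor W).

Lemma loc_functor_iso (x y : C) (w : hom x y) : W w -> is_iso (fmap L w).
Proof.
move=> Ww; exists (loc_class (LocInv Ww)); split; rewrite [LHS]loc_compE.
- exact/loc_class_eq/loc_invK.
- exact/loc_class_eq/loc_Kinv.
Qed.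

(** Every morphism of the localization is a composite of images of maps of [C] and of inverses of
    such images, and a naturality square for an invertible map can be read backwards. *)
Lemma loc_natural (E : category) (F G : functor (localization W) E)
    (a : forall x : C, hom (F x) (G x)) :
  (forall (x y : C) (f : hom x y),
     a y \mo fmap F (fmap L f) = fmap G (fmap L f) \mo a x) ->
  forall (x y : localization W) (f : hom x y), a y \mo fmap F f = fmap G f \mo a x.
Proof.
move=> an x y f; rewrite -(loc_reprK f).
elim: (loc_repr f) => {f x y} [x y f|x y w Ww|x y z v IHv u IHu].
- exact: an.
- have [wl wr] : (loc_class (LocInv Ww) : hom (y : localization W) x) \mo
      fmap L w = idm _ /\
      fmap L w \mo (loc_class (LocInv Ww) : hom (y : localization W) x) = idm _.
    split; rewrite [LHS]loc_compE; apply/loc_class_eq;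
      [exact: loc_invK | exact: loc_Kinv].
  (* Insert [G(w^-1) G(w)] on the left, move [G(w)] across [a] by hypothesis, and cancel
     [F(w) F(w^-1)]. *)
  rewrite -[LHS]comp1m -(fmap_id G) -wl fmap_comp -!compA (compA (fmap G _) (a x)).
  by rewrite -an -compA -fmap_comp wr fmap_id compm1.
- have -> : loc_class (LocComp v u) = (loc_class v : hom (y : localization W) z) \mo
      (loc_class u : hom (x : localization W) y) by rewrite [RHS]loc_compE.
  by rewrite !fmap_comp compA IHv -compA IHu compA.
Qed.

End LocalizationTheory.

Section LocalizedFunctors.
Variables (C D : category).
Variables (W : forall x y : C, hom x y -> Prop).
Variables (V : forall x y : D, hom x y -> Prop).

Lemma localized_functorE (F : functor C D)
    (FW : forall x y (f : hom x y), W f -> V (fmap F f)) (x y : C) (f : hom x y) :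
  fmap (localized_functor FW) (fmap (loc_functor W) f) =
  fmap (loc_functor V) (fmap F f).
Proof. exact/loc_class_eq/(loc_word_map_eq FW (loc_repr_class _)). Qed.

End LocalizedFunctors.

(** * Acyclic complexes and quasi-isomorphisms *)

Section AbelianCategory.
Variable A : abelian.
Implicit Types x y z w t : A.

Lemma epi_id x : epi (idm x).
Proof. by move=> z g h; rewrite !compm1. Qed.

Lemma epi_comp x y z (g : hom y z) (f : hom x y) : epi g -> epi f -> epi (g \mo f).
Proof. by move=> eg ef w h k; rewrite !compA => /ef/eg. Qed.

Lemma epi_cancel x y z (g : hom y z) (f : hom x y) : epi (g \mo f) -> epi g.
Proof. by move=> e w h k E; apply: e; rewrite !compA E. Qed.

Lemma epi_zero x y (f : hom x y) :
  (forall z (g : hom y z), g \mo f = 0 -> g = 0) -> epi f.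
Proof.
move=> f0 z g h E; apply/subr0_eq/f0.
by rewrite compDl compNm E subrr.
Qed.

Lemma epi_eq0 x y z (f : hom x y) (g : hom y z) : epi f -> g \mo f = 0 -> g = 0.
Proof. by move=> ef E; apply: ef; rewrite E comp0m. Qed.

Lemma mono_zero x y (f : hom x y) :
  (forall z (g : hom z x), f \mo g = 0 -> g = 0) -> mono f.
Proof.
move=> f0 z g h E; apply/subr0_eq/f0.
by rewrite compDr compmN E subrr.
Qed.

Lemma is_kernel_mono x y k (f : hom x y) (i : hom k x) : is_kernel f i -> mono i.
Proof.
move=> [fi ki] w g h E.
have E0 : f \mo (i \mo g) = 0 by rewrite compA fi comp0m.
by have [l [_ lu]] := ki _ _ E0; rewrite -(lu g erefl) -(lu h (esym E)).
Qed.

Lemma mono_epi_iso x y (f : hom x y) : mono f -> epi f -> is_iso f.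
Proof.
move=> mf ef; have [_ kf] := mono_normal mf.
have E0 : cokerm f \mo idm y = 0.
  by rewrite compm1; apply: epi_eq0 ef _; apply: cokerm_comp.
have [g [fg _]] := kf _ _ E0; exists g; split=> //.
by apply: mf; rewrite compA fg comp1m compm1.
Qed.

Definition bpair w x y (f : hom w x) (g : hom w y) : hom w (bip x y) :=
  in1 x y \mo f + in2 x y \mo g.

Lemma pr1_bpair w x y (f : hom w x) (g : hom w y) : pr1 x y \mo bpair f g = f.
Proof. by rewrite compDr !compA pr1_in1 pr1_in2 comp1m comp0m addr0. Qed.

Lemma pr2_bpair w x y (f : hom w x) (g : hom w y) : pr2 x y \mo bpair f g = g.
Proof. by rewrite compDr !compA pr2_in1 pr2_in2 comp1m comp0m add0r. Qed.

Lemma bip_ext w x y (f g : hom w (bip x y)) :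
  pr1 x y \mo f = pr1 x y \mo g -> pr2 x y \mo f = pr2 x y \mo g -> f = g.
Proof.
by move=> E1 E2; rewrite -[f]comp1m -[g]comp1m -bip_id !compDl -!compA E1 E2.
Qed.

Lemma bpair_comp v w x y (f : hom w x) (g : hom w y) (h : hom v w) :
  bpair f g \mo h = bpair (f \mo h) (g \mo h).
Proof. by rewrite compDl -!compA. Qed.

Lemma bpair_eta w x y (f : hom w (bip x y)) : bpair (pr1 x y \mo f) (pr2 x y \mo f) = f.
Proof. by rewrite /bpair !compA -compDl bip_id comp1m. Qed.

Lemma bpair_inj w x y (f f' : hom w x) (g g' : hom w y) :
  bpair f g = bpair f' g' -> f = f' /\ g = g'.
Proof.
by move=> E; rewrite -(pr1_bpair f g) -{2}(pr2_bpair f g) E pr1_bpair pr2_bpair.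
Qed.

Lemma bpair0 w x y : bpair (0 : hom w x) (0 : hom w y) = 0.
Proof. by rewrite /bpair !compm0 addr0. Qed.

Lemma bpairN w x y (f : hom w x) (g : hom w y) : bpair (- f) (- g) = - bpair f g.
Proof. by rewrite /bpair !compmN opprD. Qed.

Lemma bpairD w x y (f f' : hom w x) (g g' : hom w y) :
  bpair f g + bpair f' g' = bpair (f + f') (g + g').
Proof. by rewrite /bpair !compDr addrACA. Qed.

(** Epimorphisms are stable under pullback, and the pullback is the kernel of [m = e pr1 - g pr2].
    For generalized elements: [g] lifts through [e] once its domain is refined. *)
Lemma epi_pullback x y t (e : hom x y) (g : hom t y) : epi e ->
  exists (t' : A) (p : hom t' t) (h : hom t' x), epi p /\ e \mo h = g \mo p.
Proof.
move=> ee; pose m := e \mo pr1 x t - g \mo pr2 x t.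
have m1 : m \mo in1 x t = e.
  by rewrite compDl compNm -!compA pr1_in1 pr2_in1 compm1 compm0 subr0.
have em : epi m.
  by apply: (@epi_cancel _ _ _ _ (in1 x t)); rewrite m1.
exists (ker m), (pr2 x t \mo kerm m), (pr1 x t \mo kerm m); split; last first.
  have := comp_kerm m; rewrite compDl compNm => /subr0_eq.
  by rewrite -!compA.
apply: epi_zero => w s; rewrite compA => s0.
(* [m] is the cokernel of its kernel, so [s pr2] factors as [l m]; on the first summand this reads
   [l e = 0]. *)
have [_ /(_ _ _ s0)[l [lE _]]] := epi_normal em.
have l0 : l = 0.
  by apply: epi_eq0 ee _; rewrite -m1 compA lE -compA pr2_in1 compm0.
by rewrite -[s]compm1 -(pr2_in2 x t) compA -lE l0 !comp0m.
Qed.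

(** The kernel [m] of the cokernel of [b] is its image: [z] factors through [m], and [b] maps onto
    it, so that [epi_pullback] applies. *)
Lemma image_cover x y t (b : hom x y) (z : hom t y) : cokerm b \mo z = 0 ->
  exists (t' : A) (p : hom t' t) (h : hom t' x), epi p /\ b \mo h = z \mo p.
Proof.
move=> cz; pose m := kerm (cokerm b).
have [b' bE] : exists b', m \mo b' = b.
  by exists (ker_lift (cokerm_comp b)); exact: ker_liftE.
have eb' : epi b'.
  (* [b'] factors through the kernel [k] of [s]. The subobject [m k] is the kernel of its cokernel
     [q], and [q] kills [b], hence also [m]. So [m] factors through [m k], which gives [k] a section
     and forces [s = 0]. *)
  apply: epi_zero => w s s0; pose k := kerm s.
  have [b'' b'E] : exists b'', k \mo b'' = b' by exists (ker_lift s0); exact: ker_liftE.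
  have mmk : mono (m \mo k).
    by move=> v g h; rewrite -!compA => /kerm_mono/kerm_mono.
  have [_ kmk] := mono_normal mmk; set q := cokerm (m \mo k) in kmk.
  have qb : q \mo b = 0.
    have -> : q \mo b = q \mo (m \mo k) \mo b'' by rewrite -!compA b'E bE.
    by rewrite cokerm_comp comp0m.
  have qm : q \mo m = 0.
    by rewrite -(coker_descE qb) -compA comp_kerm compm0.
  have [r [rE _]] := kmk _ _ qm.
  have kr : k \mo r = idm _ by apply: (@kerm_mono _ _ _ (cokerm b)); rewrite compA compm1.
  by rewrite -[s]compm1 -kr compA comp_kerm comp0m.
have [l lE] : exists l, m \mo l = z by exists (ker_lift cz); exact: ker_liftE.
have [t' [p [h [ep E]]]] := epi_pullback l eb'.
exists t', p, h; split=> //.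
by rewrite -lE -compA -E compA bE.
Qed.

End AbelianCategory.

Lemma succz_surj (n : int) : exists m, n = succz m.
Proof. by exists (n - 1); rewrite /succz subrK. Qed.

Section Acyclic.
Variable A : abelian.
Implicit Types X Y : complex A.

(* Exactness in terms of generalized elements, up to refining the domain of the
   element by an epimorphism. *)
Definition acyclic X : Prop :=
  forall n (t : A) (z : hom t (X (succz n))), diff X (succz n) \mo z = 0 ->
  exists (t' : A) (p : hom t' t) (x : hom t' (X n)),
    epi p /\ diff X n \mo x = z \mo p.

(** A cycle factors through the kernel, where an epimorphism lifts it. For the converse it is enough
    to test the universal cycle [kerm (diff X (succz n))]. *)
Lemma acyclicP X : (forall n, epi (boundary X n)) <-> acyclic X.
Proof.
split=> [eb n t z z0|aX n].
  have [t' [p [h [ep E]]]] := epi_pullback (ker_lift z0) (eb n).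
  exists t', p, h; split=> //.
  by rewrite -[diff X n](ker_liftE (diffK X n)) -compA [_ \mo h]E compA ker_liftE.
have [t' [p [x [ep E]]]] := aX n _ _ (comp_kerm (diff X (succz n))).
apply: (@epi_cancel _ _ _ _ _ x); suff -> : boundary X n \mo x = p by [].
by apply: kerm_mono; rewrite compA ker_liftE.
Qed.

Lemma acyclic_boundary X n : acyclic X -> epi (boundary X n).
Proof. by move/acyclicP. Qed.

Lemma acyclic_retract X Y (f : chain_map X Y) (g : chain_map Y X) :
  (forall n, g n \mo f n = idm _) -> acyclic Y -> acyclic X.
Proof.
move=> gf aY n t z z0.
have fz0 : diff Y (succz n) \mo (f (succz n) \mo z) = 0.
  by rewrite compA -cm_diff -compA z0 compm0.
have [t' [p [y [ep E]]]] := aY _ _ _ fz0.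
exists t', p, (g n \mo y); split=> //.
by rewrite compA -cm_diff -compA E -compA compA gf comp1m.
Qed.

Lemma pr1_diff_cone X Y (f : chain_map X Y) n :
  pr1 _ _ \mo diff (cone f) n = - (diff X (succz n) \mo pr1 _ _).
Proof. by rewrite -compNm; apply: pr1_cone_diff. Qed.

Lemma pr2_diff_cone X Y (f : chain_map X Y) n :
  pr2 _ _ \mo diff (cone f) n = f (succz n) \mo pr1 _ _ + diff Y n \mo pr2 _ _.
Proof. exact: pr2_cone_diff. Qed.

Lemma diff_cone_bpair X Y (f : chain_map X Y) n (t : A) (x : hom t (X (succz n)))
    (y : hom t (Y n)) :
  diff (cone f) n \mo bpair x y =
  bpair (- (diff X (succz n) \mo x)) (f (succz n) \mo x + diff Y n \mo y).
Proof.
apply: bip_ext; rewrite compA.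
  by rewrite pr1_diff_cone compNm -(compA (diff X _)) !pr1_bpair.
by rewrite pr2_diff_cone compDl -(compA (diff Y _)) -(compA (f _)) !pr2_bpair pr1_bpair.
Qed.

Section HomologyElements.
Variable X : complex A.
Variable n : int.

Lemma homology_lift (t : A) (h : hom t (homology X n)) :
  exists (t' : A) (p : hom t' t) (z : hom t' (ker (diff X (succz n)))),
    epi p /\ cokerm (boundary X n) \mo z = h \mo p.
Proof. exact: (epi_pullback h (@cokerm_epi _ _ _ (boundary X n))). Qed.

Lemma homology_zero (t : A) (z : hom t (ker (diff X (succz n)))) :
  cokerm (boundary X n) \mo z = 0 ->
  exists (t' : A) (p : hom t' t) (x : hom t' (X n)),
    epi p /\ diff X n \mo x = kerm (diff X (succz n)) \mo z \mo p.
Proof.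
move=> /image_cover[t' [p [x [ep E]]]]; exists t', p, x; split=> //.
by rewrite -compA -E compA ker_liftE.
Qed.
End HomologyElements.

Section QuasiIsoCone.
Variables (X Y : complex A) (f : chain_map X Y).

Lemma homology_mapE n :
  homology_map f n \mo cokerm (boundary X n) = cokerm (boundary Y n) \mo cycle_map f n.
Proof. exact: coker_descE. Qed.

Lemma cycle_mapE n : kerm (diff Y (succz n)) \mo cycle_map f n =
  f (succz n) \mo kerm (diff X (succz n)).
Proof. exact: ker_liftE. Qed.

Lemma cone_cycle n (t : A) (z : hom t (cone f n)) : diff (cone f) n \mo z = 0 ->
  diff X (succz n) \mo (pr1 _ _ \mo z) = 0 /\
  f (succz n) \mo (pr1 _ _ \mo z) = - (diff Y n \mo (pr2 _ _ \mo z)).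
Proof.
move=> z0; have := congr1 (comp (pr1 _ _)) z0; have := congr1 (comp (pr2 _ _)) z0.
rewrite !compm0 !compA pr1_diff_cone pr2_diff_cone compDl -!compA.
move=> E2; rewrite compNm -!compA => E1; split; first by rewrite -[LHS]opprK E1 oppr0.
by apply/eqP; rewrite -addr_eq0; apply/eqP.
Qed.

(** A chase replaces the long exact sequence. For a cycle [(x, y)] of the cone, injectivity on
    homology gives [x = d x1]. Surjectivity one degree lower gives [y + f x1 = f z3 + d y3] with
    [z3] a cycle of [X]. Then [(z3 - x1, y3)] is a preimage. All equalities hold after
    refinement. *)
Lemma quasi_iso_acyclic : quasi_iso (f : hom (X : complex_cat A) Y) -> acyclic (cone f).
Proof.
move=> qf n t z /cone_cycle; set x := pr1 _ _ \mo z; set y := pr2 _ _ \mo z.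
move=> [x0 fx].
have zE : z = bpair x y by apply: bip_ext; rewrite ?pr1_bpair ?pr2_bpair.
clearbody x y.
have [z1 z1E] : exists z1, kerm (diff X (succz (succz n))) \mo z1 = x.
  by exists (ker_lift x0); exact: ker_liftE.
have cz1 : cokerm (boundary X (succz n)) \mo z1 = 0.
  have [g [gh _]] := qf (succz n).
  rewrite -[LHS]comp1m -gh -compA (compA (homology_map _ _)) homology_mapE.
  have -> : cokerm (boundary Y (succz n)) \mo cycle_map f (succz n) \mo z1 = 0.
    have -> : cokerm (boundary Y (succz n)) \mo cycle_map f (succz n) \mo z1 =
        cokerm (boundary Y (succz n)) \mo (boundary Y (succz n) \mo (- y)).
      rewrite -compA; congr (_ \mo _); apply: kerm_mono.
      by rewrite !compA cycle_mapE ker_liftE -compA z1E fx compmN.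
    by rewrite compA cokerm_comp comp0m.
  by rewrite compm0.
have [t1 [p1 [x1 [ep1 Ex1]]]] := homology_zero cz1; rewrite z1E in Ex1.
have cy : diff Y (succz n) \mo (y \mo p1 + f (succz n) \mo x1) = 0.
  rewrite compDr (compA _ (f _)) -cm_diff -compA Ex1 !compA -compDl fx.
  by rewrite addrN comp0m.
have [z2 z2E] : exists z2, kerm (diff Y (succz n)) \mo z2 = y \mo p1 + f (succz n) \mo x1.
  by exists (ker_lift cy); exact: ker_liftE.
have [g [_ hg]] := qf n.
have [t2 [p2 [z3 [ep2 Ez3]]]] := homology_lift (g \mo (cokerm (boundary Y n) \mo z2)).
have cz3 : cokerm (boundary Y n) \mo (z2 \mo p2 - cycle_map f n \mo z3) = 0.
  rewrite compDr compmN (compA _ (cycle_map f n)) -homology_mapE -compA Ez3.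
  by rewrite -!compA (compA _ g) hg comp1m subrr.
have [t3 [p3 [y3 [ep3 Ey3]]]] := homology_zero cz3.
have {}Ey3 : diff Y n \mo y3 = y \mo (p1 \mo p2 \mo p3) + f (succz n) \mo
    (x1 \mo p2 \mo p3 - kerm (diff X (succz n)) \mo z3 \mo p3).
  rewrite Ey3 compDr compmN (compA _ z2) z2E (compA _ (cycle_map f n)) cycle_mapE.
  by rewrite !compDl compNm !compDr compmN -!compA addrA.
exists t3, (p1 \mo p2 \mo p3), (bpair (kerm (diff X (succz n)) \mo z3 \mo p3
  - x1 \mo p2 \mo p3) y3); split; first by do !apply: epi_comp => //.
rewrite zE (bpair_comp x y) [LHS]diff_cone_bpair; congr bpair.
  by rewrite compDr compmN !compA comp_kerm !comp0m sub0r opprK Ex1.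
by rewrite Ey3 addrCA -compDr addrA subrK subrr compm0 addr0.
Qed.

(** Injectivity: if [f z = d y], then [(z, - y)] is a cycle of the cone, and a preimage shows that
    [z] is a boundary. Surjectivity: for the universal cycle [c] of [Y], a preimage of [(0, c)]
    writes [c] as [f] of a cycle plus a boundary. *)
Lemma acyclic_quasi_iso : acyclic (cone f) -> quasi_iso (f : hom (X : complex_cat A) Y).
Proof.
(* [acyclic] speaks of degrees written [succz n], while the cycle [(z, - y)] of the injectivity part
   lies in degree [m] of the cone. *)
move=> aC m; have [n ->] := succz_surj m; apply: mono_epi_iso.
  apply: mono_zero => t g g0.
  have [t1 [p1 [z [ep1 Ez]]]] := homology_lift g.
  have cz : cokerm (boundary Y (succz n)) \mo (cycle_map f (succz n) \mo z) = 0.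
    by rewrite compA -homology_mapE -compA Ez compA g0 comp0m.
  have [t2 [p2 [y [ep2 Ey]]]] := homology_zero cz.
  have c0 : diff (cone f) (succz n) \mo
      bpair (kerm (diff X (succz (succz n))) \mo z \mo p2) (- y) = 0.
    rewrite [LHS]diff_cone_bpair !compA comp_kerm !comp0m oppr0 -cycle_mapE.
    by rewrite compmN Ey !compA subrr bpair0.
  have [t3 [p3 [v [ep3 Ev]]]] := aC _ _ _ c0.
  rewrite -(bpair_eta v) (bpair_comp _ (- y)) in Ev.
  have {Ev} [Ev _] := bpair_inj (etrans (esym (diff_cone_bpair _ _ _)) Ev).
  rewrite -!compA -compmN in Ev.
  have {}Ev : z \mo (p2 \mo p3) = boundary X (succz n) \mo (- (pr1 _ _ \mo v)).
    by apply: kerm_mono; rewrite -Ev [RHS]compA ker_liftE.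
  apply: (epi_eq0 (epi_comp ep1 (epi_comp ep2 ep3))).
  by rewrite compA -Ez -compA Ev compA cokerm_comp comp0m.
apply: epi_zero => w s s0.
have c0 : diff (cone f) (succz (succz n)) \mo
    bpair 0 (kerm (diff Y (succz (succz n)))) = 0.
  by rewrite [LHS]diff_cone_bpair !compm0 comp_kerm oppr0 addr0 bpair0.
have [t1 [p1 [v [ep1 Ev]]]] := aC _ _ _ c0.
rewrite -(bpair_eta v) (bpair_comp 0) comp0m in Ev.
have {Ev} [Ev1 Ev2] := bpair_inj (etrans (esym (diff_cone_bpair _ _ _)) Ev).
have x0 : diff X (succz (succz n)) \mo (pr1 _ _ \mo v) = 0.
  by apply: oppr_inj; rewrite oppr0.
apply: (@cokerm_epi _ _ _ (boundary Y (succz n))); rewrite comp0m.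
apply: (epi_eq0 ep1).
have -> : p1 = cycle_map f (succz n) \mo ker_lift x0 +
     boundary Y (succz n) \mo (pr2 _ _ \mo v).
  apply: kerm_mono; rewrite -Ev2 compDr !compA cycle_mapE.
  by rewrite -(compA _ _ (ker_lift _)) !ker_liftE compA.
rewrite -(compA s) compDr !(compA (cokerm _)) cokerm_comp comp0m addr0 -homology_mapE.
by rewrite !compA s0 !comp0m.
Qed.

End QuasiIsoCone.

(** The chase of [quasi_iso_acyclic] with [z3 = 0]: from [x = d x1] and [y + f x1 = d y2] one gets
    the preimage [(- x1, y2)]. *)
Lemma acyclic_cone X Y (f : chain_map X Y) : acyclic X -> acyclic Y -> acyclic (cone f).
Proof.
move=> aX aY n t z /cone_cycle; set x := pr1 _ _ \mo z; set y := pr2 _ _ \mo z.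
move=> [x0 fx].
have zE : z = bpair x y by apply: bip_ext; rewrite ?pr1_bpair ?pr2_bpair.
clearbody x y.
have [t1 [p1 [x1 [ep1 Ex1]]]] := aX _ _ _ x0.
have cy : diff Y (succz n) \mo (y \mo p1 + f (succz n) \mo x1) = 0.
  rewrite compDr (compA _ (f _)) -cm_diff -compA Ex1 !compA -compDl fx.
  by rewrite addrN comp0m.
have [t2 [p2 [y2 [ep2 Ey2]]]] := aY _ _ _ cy.
exists t2, (p1 \mo p2), (bpair (- (x1 \mo p2)) y2); split; first exact: epi_comp.
rewrite zE (bpair_comp x y) [LHS]diff_cone_bpair; congr bpair.
  by rewrite compmN opprK compA Ex1 compA.
by rewrite Ey2 compmN compDl !compA addrC addrK.
Qed.

End Acyclic.

(** * Cones of transformations between exact functors *)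

Lemma bip_elim (A : abelian) (x y z : A) (f g : hom (bip x y) z) :
  (forall (t : A) (a : hom t x) (b : hom t y), f \mo bpair a b = g \mo bpair a b) ->
  f = g.
Proof. by move=> E; have := E _ (pr1 x y) (pr2 x y); rewrite /bpair bip_id !compm1. Qed.

Section ComplexIso.
Variable A : abelian.
Implicit Types X Y : complex_cat A.

Lemma complex_iso X Y (f : hom X Y) : (forall n, is_iso (cm f n)) -> is_iso f.
Proof.
move=> fi; pose g n := projT1 (cid (fi n)).
have gf n : g n \mo cm f n = idm _ by rewrite /g; case: cid => h [].
have fg n : cm f n \mo g n = idm _ by rewrite /g; case: cid => h [].
have gd n : g (succz n) \mo diff Y n = diff X n \mo g n.
  rewrite -[LHS]compm1 -(fg n) -compA (compA (diff Y n)) -cm_diff -compA.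
  by rewrite compA gf comp1m.
by exists (ChainMap gd); split; apply: chain_mapP.
Qed.

Lemma acyclic_iso X Y (f : hom X Y) : is_iso f -> acyclic X -> acyclic Y.
Proof.
move=> [g [gf fg]]; apply: (@acyclic_retract _ _ _ g f) => n.
by have := congr1 (fun h : chain_map Y Y => cm h n) fg.
Qed.

End ComplexIso.

(** * Functors of complexes that induce triangle functors *)

Section TriangleFunctor.
Variables (A B : abelian) (F : functor (complex_cat A) (complex_cat B)).
Hypothesis Fq : forall (X Y : complex_cat A) (f : hom X Y),
  quasi_iso f -> quasi_iso (fmap F f).
Variable s : nat_trans (functor_comp F (complex_shift A))
                       (functor_comp (complex_shift B) F).
Hypothesis iso_s : is_nat_iso s.
Variable theta : forall (X Y : complex_cat A) (f : hom X Y),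
  hom (F (cone f)) (cone (fmap F f) : complex_cat B).
Hypothesis iso_theta : forall X Y (f : hom X Y), is_iso (theta f).
Hypothesis theta_in : forall (X Y : complex_cat A) (f : hom X Y),
  theta f \mo fmap F (cone_in f : hom Y (cone f : complex_cat A)) = cone_in (fmap F f).
Hypothesis theta_pr : forall (X Y : complex_cat A) (f : hom X Y),
  s X \mo fmap F (cone_pr f : hom (cone f : complex_cat A) (shift_ob X)) =
  (cone_pr (fmap F f) : hom (cone (fmap F f) : complex_cat B) _) \mo theta f.

Local Notation dF := (localized_functor Fq).

Fact localized_shift_natural (X Y : derived_category A) (f : hom X Y) :
  fmap (to_derived B) (s Y) \mo fmap (functor_comp dF (derived_shift A)) f =
  fmap (functor_comp (derived_shift B) dF) f \mo fmap (to_derived B) (s X).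
Proof.
apply: (@loc_natural _ _ _ (functor_comp dF (derived_shift A))
  (functor_comp (derived_shift B) dF) (fun X => fmap (to_derived B) (s X))) => {}X {}Y {}f.
have -> : fmap (functor_comp dF (derived_shift A)) (fmap (to_derived A) f) =
    fmap (to_derived B) (fmap F (fmap (complex_shift A) f)).
  exact: etrans (congr1 (fmap dF) (localized_functorE _ _)) (localized_functorE _ _).
have -> : fmap (functor_comp (derived_shift B) dF) (fmap (to_derived A) f) =
    fmap (to_derived B) (fmap (complex_shift B) (fmap F f)).
  exact: etrans (congr1 (fmap (derived_shift B)) (localized_functorE _ _))
    (localized_functorE _ _).
rewrite -[LHS](fmap_comp (to_derived B)) -[RHS](fmap_comp (to_derived B)).
by congr (fmap (to_derived B) _); apply: (nt_natural s f).
Qed.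

Definition localized_shift :
    nat_trans (functor_comp dF (@shift (derived A)))
              (functor_comp (@shift (derived B)) dF) :=
  @NatTrans _ _ (functor_comp dF (derived_shift A))
    (functor_comp (derived_shift B) dF) _ localized_shift_natural.

(** A triangle isomorphic to the cone triangle of [f] is sent to one isomorphic to the cone triangle
    of [fmap F f]: on the third vertex, [fmap dF c] is followed by [theta f]. *)
Lemma tri_equivalent_localized :
  is_equivalence dF -> tri_equivalent (derived A) (derived B).
Proof.
move=> eF; exists dF, localized_shift; split=> //.
  by move=> X; apply: (is_iso_fmap (to_derived B) (iso_s X)).
move=> x y z u v w [X [Y [f [a [b [c [[ia ib ic] [E1 E2 E3]]]]]]]].
exists (F X), (F Y), (fmap F f), (fmap dF a), (fmap dF b),
  (fmap (to_derived B) (theta f) \mo fmap dF c); split; split.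
- exact: is_iso_fmap.
- exact: is_iso_fmap.
- by apply: is_iso_comp; [apply: is_iso_fmap | apply: is_iso_fmap].
- by rewrite -fmap_comp E1 fmap_comp localized_functorE.
- rewrite -compA -fmap_comp E2 fmap_comp localized_functorE compA.
  by rewrite -[X in X \mo _](fmap_comp (to_derived B)) theta_in.
(* [a] is a morphism of the derived category and not a chain map, so naturality on the localization
   is required here. *)
- rewrite compA -[fmap _ _ \mo _](localized_shift_natural a) -compA -fmap_comp.
  rewrite [_ \mo w]E3 fmap_comp localized_functorE !compA.
  rewrite -[X in X \mo _](fmap_comp (to_derived B)) [s X \mo _]theta_pr.
  by rewrite [X in X \mo _](fmap_comp (to_derived B)).
Qed.

End TriangleFunctor.

(** * Exact functors and their action on complexes *)

Record exact_functor (A B : abelian) : Type := ExactFunctor {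
  ef :> functor A B;
  efD : forall (x y : A) (f g : hom x y), fmap ef (f + g) = fmap ef f + fmap ef g;
  ef_ker : forall (x y : A) (f : hom x y), is_kernel (fmap ef f) (fmap ef (kerm f));
  ef_epi : forall (x y : A) (f : hom x y), epi f -> epi (fmap ef f) }.

Section ExactFunctor.
Variables (A B : abelian) (U : exact_functor A B).

Lemma ef0 (x y : A) : fmap U (0 : hom x y) = 0.
Proof. by apply: (addrI (fmap U 0)); rewrite -efD !addr0. Qed.

Lemma efN (x y : A) (f : hom x y) : fmap U (- f) = - fmap U f.
Proof. by apply: (addrI (fmap U f)); rewrite -efD !subrr ef0. Qed.

Lemma ef_pr1_in1 (x y : A) : fmap U (pr1 x y) \mo fmap U (in1 x y) = idm _.
Proof. by rewrite -fmap_comp pr1_in1 fmap_id. Qed.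
Lemma ef_pr2_in2 (x y : A) : fmap U (pr2 x y) \mo fmap U (in2 x y) = idm _.
Proof. by rewrite -fmap_comp pr2_in2 fmap_id. Qed.
Lemma ef_pr1_in2 (x y : A) : fmap U (pr1 x y) \mo fmap U (in2 x y) = 0.
Proof. by rewrite -fmap_comp pr1_in2 ef0. Qed.
Lemma ef_pr2_in1 (x y : A) : fmap U (pr2 x y) \mo fmap U (in1 x y) = 0.
Proof. by rewrite -fmap_comp pr2_in1 ef0. Qed.

Lemma ef_bip_id (x y : A) : fmap U (in1 x y) \mo fmap U (pr1 x y) +
  fmap U (in2 x y) \mo fmap U (pr2 x y) = idm _.
Proof. by rewrite -!fmap_comp -efD bip_id fmap_id. Qed.

(** [U (bip x y)] is a biproduct of [U x] and [U y] without being the chosen one, so maps into it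
    are compared through [fmap U] of the projections. *)
Lemma ef_bip_ext (x y : A) (t : B) (f g : hom t (U (bip x y))) :
  fmap U (pr1 x y) \mo f = fmap U (pr1 x y) \mo g ->
  fmap U (pr2 x y) \mo f = fmap U (pr2 x y) \mo g -> f = g.
Proof.
by move=> E1 E2; rewrite -[f]comp1m -[g]comp1m -ef_bip_id !compDl -!compA E1 E2.
Qed.

Fact complex_map_subproof (X : complex A) n :
  fmap U (diff X (succz n)) \mo fmap U (diff X n) = 0.
Proof. by rewrite -fmap_comp diffK ef0. Qed.

Definition complex_map (X : complex A) : complex B :=
  @Complex B (fun n => U (X n)) _ (complex_map_subproof X).

(** Since [U] preserves kernels, a cycle of the image complex factors through [U] of the cycles of
    [X], onto which [U] of the boundary map is still an epimorphism. *)
Lemma acyclic_complex_map (X : complex A) : acyclic X -> acyclic (complex_map X).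
Proof.
move=> aX n t z z0; have [_ /(_ _ _ z0)[h [<- _]]] := ef_ker U (diff X (succz n)).
have eb := ef_epi (e := U) (acyclic_boundary (n := n) aX).
have [t' [p [x [ep E]]]] := epi_pullback h eb.
exists t', p, x; split=> //.
by rewrite -compA -E compA -fmap_comp ker_liftE.
Qed.

Lemma ef_pr1_diff_cone (X Y : complex A) (f : chain_map X Y) n (t : B)
    (a : hom t (U (cone f n))) :
  fmap U (pr1 _ _) \mo (fmap U (diff (cone f) n) \mo a) =
  - (fmap U (diff X (succz n)) \mo (fmap U (pr1 _ _) \mo a)).
Proof. by rewrite [LHS]compA -fmap_comp pr1_diff_cone efN fmap_comp compNm -compA. Qed.

Lemma ef_pr2_diff_cone (X Y : complex A) (f : chain_map X Y) n (t : B)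
    (a : hom t (U (cone f n))) :
  fmap U (pr2 _ _) \mo (fmap U (diff (cone f) n) \mo a) =
  fmap U (f (succz n)) \mo (fmap U (pr1 _ _) \mo a) +
  fmap U (diff Y n) \mo (fmap U (pr2 _ _) \mo a).
Proof.
by rewrite [LHS]compA -fmap_comp pr2_diff_cone efD !fmap_comp compDl -!compA.
Qed.

End ExactFunctor.

Section ConeFunctor.
Variables (A B : abelian) (U V : exact_functor A B) (al : nat_trans U V).
Implicit Types X Y : complex A.

Definition complex_map_nat X : chain_map (complex_map U X) (complex_map V X) :=
  @ChainMap B (complex_map U X) (complex_map V X) (fun n => al (X n))
    (fun n => nt_natural al (diff X n)).

Definition cone_ob X : complex B := cone (complex_map_nat X).

Lemma diff_cone_ob_bpair X n (t : B) (a : hom t (U (X (succz n)))) (b : hom t (V (X n))) :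
  diff (cone_ob X) n \mo bpair a b =
  bpair (- (fmap U (diff X (succz n)) \mo a)) (al _ \mo a + fmap V (diff X n) \mo b).
Proof. exact: diff_cone_bpair. Qed.

Definition cone_map_comp X Y (f : chain_map X Y) n : hom (cone_ob X n) (cone_ob Y n) :=
  bpair (fmap U (f (succz n)) \mo pr1 _ _) (fmap V (f n) \mo pr2 _ _).

Lemma cone_map_bpair X Y (f : chain_map X Y) n (t : B)
    (a : hom t (U (X (succz n)))) (b : hom t (V (X n))) :
  cone_map_comp f n \mo bpair a b = bpair (fmap U (f (succz n)) \mo a) (fmap V (f n) \mo b).
Proof. by rewrite [LHS]bpair_comp -!compA pr1_bpair pr2_bpair. Qed.

Fact cone_map_diff X Y (f : chain_map X Y) n :
  cone_map_comp f (succz n) \mo diff (cone_ob X) n =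
  diff (cone_ob Y) n \mo cone_map_comp f n.
Proof.
apply: bip_elim => t a b.
rewrite -!compA diff_cone_ob_bpair !cone_map_bpair diff_cone_ob_bpair.
rewrite compmN compDr !compA -!fmap_comp !cm_diff; congr (bpair _ (_ \mo _ + _)).
by rewrite nt_natural.
Qed.

Definition cone_map X Y (f : chain_map X Y) : chain_map (cone_ob X) (cone_ob Y) :=
  ChainMap (cone_map_diff f).

Definition cone_functor : functor (complex_cat A) (complex_cat B).
Proof.
refine (@Functor (complex_cat A) (complex_cat B) cone_ob cone_map _ _).
- move=> X; apply: chain_mapP => n; apply: bip_elim => t a b.
  by rewrite [LHS]cone_map_bpair !fmap_id !comp1m.
- move=> X Y Z g f; apply: chain_mapP => n; apply: bip_elim => t a b.
  by rewrite [LHS]cone_map_bpair -[RHS]compA !cone_map_bpair !fmap_comp !compA.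
Defined.

Section Shift.
Variable X : complex A.

(* The differentials of the cone of a shift and of the shift of a cone differ by a sign. *)
Definition cone_shift_comp n : hom (cone_ob (shift_ob X) n) (shift_ob (cone_ob X) n) :=
  bpair (- pr1 _ _) (pr2 _ _).

Lemma cone_shift_bpair n (t : B)
    (a : hom t (U (X (succz (succz n))))) (b : hom t (V (X (succz n)))) :
  cone_shift_comp n \mo bpair a b = bpair (- a) b.
Proof. by rewrite [LHS]bpair_comp compNm pr1_bpair pr2_bpair. Qed.

Fact cone_shift_diff n : cone_shift_comp (succz n) \mo diff (cone_ob (shift_ob X)) n =
  diff (shift_ob (cone_ob X)) n \mo cone_shift_comp n.
Proof.
apply: bip_elim => t a b.
rewrite -!compA diff_cone_ob_bpair !cone_shift_bpair [RHS]compNm.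
rewrite (@diff_cone_ob_bpair X (succz n) t (- a) b) /=.
rewrite !efN !compNm !compmN !opprK -bpairN.
by rewrite opprD opprK.
Qed.

Definition cone_shift : chain_map (cone_ob (shift_ob X)) (shift_ob (cone_ob X)) :=
  ChainMap cone_shift_diff.

Lemma cone_shift_iso :
  is_iso (cone_shift : hom (cone_ob (shift_ob X) : complex_cat B) (shift_ob (cone_ob X))).
Proof.
have invK n : cone_shift_comp n \mo cone_shift_comp n = idm _.
  apply: bip_elim => t a b.
  by rewrite -compA cone_shift_bpair (@cone_shift_bpair n t (- a) b) opprK [RHS]comp1m.
by apply: complex_iso => n; exists (cone_shift_comp n); split; apply: invK.
Qed.
End Shift.

Section Cone.
Variables (X Y : complex A) (f : chain_map X Y).

(** Interchange of two cones: the middle summands [V X] and [U Y] trade places. The sign sits on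
    [U X], which is shifted twice: the differential components from it to [U Y] and to [V X] have
    opposite signs on the two sides. *)
Definition cone_cone_comp n : hom (cone_ob (cone f) n) (cone (cone_map f) n) :=
  bpair (bpair (- (fmap U (pr1 _ _) \mo pr1 _ _)) (fmap V (pr1 _ _) \mo pr2 _ _))
        (bpair (fmap U (pr2 _ _) \mo pr1 _ _) (fmap V (pr2 _ _) \mo pr2 _ _)).

Lemma cone_cone_bpair n (t : B) (a : hom t (U (cone f (succz n)))) (b : hom t (V (cone f n))) :
  cone_cone_comp n \mo bpair a b =
  bpair (bpair (- (fmap U (pr1 _ _) \mo a)) (fmap V (pr1 _ _) \mo b))
        (bpair (fmap U (pr2 _ _) \mo a) (fmap V (pr2 _ _) \mo b)).
Proof.
rewrite [LHS]bpair_comp (bpair_comp (- _)) (bpair_comp (fmap U _ \mo _)).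
by rewrite compNm -!compA !pr1_bpair !pr2_bpair.
Qed.

Fact cone_cone_diff n : cone_cone_comp (succz n) \mo diff (cone_ob (cone f)) n =
  diff (cone (cone_map f)) n \mo cone_cone_comp n.
Proof.
apply: bip_elim => t a b.
rewrite -!compA diff_cone_ob_bpair !cone_cone_bpair [RHS]diff_cone_bpair.
rewrite (@diff_cone_ob_bpair X (succz n) t) (@diff_cone_ob_bpair Y n t).
rewrite (@cone_map_bpair X Y f (succz n) t) bpairD -bpairN.
congr (bpair (bpair _ _) (bpair _ _)).
- by rewrite !compmN !opprK ef_pr1_diff_cone.
- by rewrite compDr ef_pr1_diff_cone compmN opprD opprK !compA nt_natural.
- by rewrite !compmN ef_pr2_diff_cone opprD.
- by rewrite compDr ef_pr2_diff_cone !compA nt_natural addrCA.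
Qed.

Definition cone_cone : chain_map (cone_ob (cone f)) (cone (cone_map f)) :=
  ChainMap cone_cone_diff.

Lemma cone_cone_iso :
  is_iso (cone_cone : hom (cone_ob (cone f) : complex_cat B) (cone (cone_map f))).
Proof.
apply: complex_iso => n.
pose inv : hom (cone (cone_map f) n) (cone_ob (cone f) n) := bpair
  (fmap U (in2 _ _) \mo (pr1 _ _ \mo pr2 _ _) - fmap U (in1 _ _) \mo (pr1 _ _ \mo pr1 _ _))
  (fmap V (in1 _ _) \mo (pr2 _ _ \mo pr1 _ _) + fmap V (in2 _ _) \mo (pr2 _ _ \mo pr2 _ _)).
have invE (t : B) (a1 : hom t (U (X (succz (succz n))))) (a2 : hom t (V (X (succz n))))
    (b1 : hom t (U (Y (succz n)))) (b2 : hom t (V (Y n))) :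
    inv \mo bpair (bpair a1 a2) (bpair b1 b2) =
    bpair (fmap U (in2 _ _) \mo b1 - fmap U (in1 _ _) \mo a1)
          (fmap V (in1 _ _) \mo a2 + fmap V (in2 _ _) \mo b2).
  by rewrite [LHS]bpair_comp !compDl compNm -!compA !(pr1_bpair, pr2_bpair).
exists inv; split; apply: bip_elim => t a b; rewrite -compA comp1m.
- rewrite [X in inv \mo X]cone_cone_bpair [LHS]invE compmN opprK !compA addrC -!compDl.
  by rewrite !ef_bip_id !comp1m.
- rewrite -(bpair_eta a) -(bpair_eta b) invE [LHS]cone_cone_bpair !compDr !compmN !compA.
  rewrite !(ef_pr1_in1, ef_pr2_in2, ef_pr1_in2, ef_pr2_in1) !comp0m !comp1m.
  by rewrite oppr0 sub0r opprK !addr0 !add0r.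
Qed.

Lemma cone_cone_in : (cone_cone : hom (cone_ob (cone f) : complex_cat B) _) \mo
  fmap cone_functor (cone_in f : hom (Y : complex_cat A) (cone f)) =
  cone_in (cone_map f).
Proof.
apply: chain_mapP => n; apply: bip_elim => t a b.
rewrite -[LHS]compA [X in _ \mo X]cone_map_bpair [LHS]cone_cone_bpair.
rewrite !compA !(ef_pr1_in1, ef_pr2_in2, ef_pr1_in2, ef_pr2_in1) !comp0m !comp1m.
by rewrite oppr0 bpair0 /bpair compm0 add0r.
Qed.

(** The sign on [U X] in [cone_cone] is exactly the one in [cone_shift]. *)
Lemma cone_cone_pr : (cone_shift X : hom (cone_ob (shift_ob X) : complex_cat B) _) \mo
  fmap cone_functor (cone_pr f : hom (cone f : complex_cat A) (shift_ob X)) =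
  (cone_pr (cone_map f) : hom (cone (cone_map f) : complex_cat B) _) \mo
  (cone_cone : hom (cone_ob (cone f) : complex_cat B) _).
Proof.
apply: chain_mapP => n; apply: bip_elim => t a b.
rewrite -[LHS]compA [X in _ \mo X]cone_map_bpair [LHS]cone_shift_bpair.
by rewrite -[RHS]compA [X in _ = _ \mo X]cone_cone_bpair [RHS]pr1_bpair.
Qed.

End Cone.

(** By [cone_cone], the cone of the image of [f] is isomorphic to the cone of a map between the
    images of [cone f] under [U] and [V], both acyclic. *)
Lemma cone_functor_quasi_iso (X Y : complex_cat A) (f : hom X Y) :
  quasi_iso f -> quasi_iso (fmap cone_functor f).
Proof.
move=> /quasi_iso_acyclic af; apply: acyclic_quasi_iso.
apply: acyclic_iso (cone_cone_iso f) _.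
by apply: acyclic_cone; apply: acyclic_complex_map.
Qed.

Fact cone_shift_natural (X Y : complex_cat A) (f : hom X Y) :
  (cone_shift Y : hom (cone_ob (shift_ob Y) : complex_cat B) _) \mo
    fmap (functor_comp cone_functor (complex_shift A)) f =
  fmap (functor_comp (complex_shift B) cone_functor) f \mo cone_shift X.
Proof.
apply: chain_mapP => n; apply: bip_elim => t a b.
rewrite -[LHS]compA [X in _ \mo X]cone_map_bpair [LHS]cone_shift_bpair.
rewrite -[RHS]compA [X in _ = _ \mo X]cone_shift_bpair.
by rewrite [RHS](@cone_map_bpair X Y f (succz n) t (- a) b) compmN.
Qed.

Definition derived_cone : functor (derived_category A) (derived_category B) :=
  @localized_functor _ _ (@quasi_iso A) (@quasi_iso B) _ cone_functor_quasi_iso.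

Lemma tri_equivalent_cone :
  is_equivalence derived_cone -> tri_equivalent (derived A) (derived B).
Proof.
pose s := @NatTrans _ _ (functor_comp cone_functor (complex_shift A))
  (functor_comp (complex_shift B) cone_functor) _ cone_shift_natural.
apply: (@tri_equivalent_localized _ _ _ _ s _ cone_cone).
- exact: cone_shift_iso.
- exact: cone_cone_iso.
- exact: cone_cone_in.
- exact: cone_cone_pr.
Qed.

End ConeFunctor.

(** * Localized functors and the shift *)

Section LocalizedNat.
Variables (C D : category).
Variables (W : forall x y : C, hom x y -> Prop).
Variables (V : forall x y : D, hom x y -> Prop).

(** The components are inverted by the localization. This turns natural quasi-isomorphisms of
    complexes into isomorphisms of derived functors. *)
Lemma localized_nat_isomorphic (F G : functor C D)
    (FW : forall x y (f : hom x y), W f -> V (fmap F f))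
    (GW : forall x y (f : hom x y), W f -> V (fmap G f)) (a : nat_trans F G) :
  (forall x, V (a x)) ->
  nat_isomorphic (localized_functor FW) (localized_functor GW).
Proof.
move=> aV; have n (x y : localization W) (f : hom x y) :
    fmap (loc_functor V) (a y) \mo fmap (localized_functor FW) f =
    fmap (localized_functor GW) f \mo fmap (loc_functor V) (a x).
  apply: (@loc_natural _ _ _ (localized_functor FW) (localized_functor GW)
    (fun x => fmap (loc_functor V) (a x))) => {}x {}y {}f.
  rewrite !localized_functorE -[LHS](fmap_comp (loc_functor V)).
  by rewrite -[RHS](fmap_comp (loc_functor V)) nt_natural.
exists (@NatTrans _ _ (localized_functor FW) (localized_functor GW) _ n) => x.
exact: loc_functor_iso.
Qed.

End LocalizedNat.

(** The two functors agree on objects by conversion, so identities serve as components; on morphisms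
    they involve different choices of representative words, hence the appeal to [loc_natural]. *)
Lemma localized_functor_comp (C D E : category)
    (W : forall x y : C, hom x y -> Prop) (V : forall x y : D, hom x y -> Prop)
    (T : forall x y : E, hom x y -> Prop) (G : functor D E) (F : functor C D)
    (FW : forall x y (f : hom x y), W x y f -> V _ _ (fmap F f))
    (GV : forall x y (f : hom x y), V x y f -> T _ _ (fmap G f))
    (GFW : forall x y (f : hom x y), W x y f -> T _ _ (fmap (functor_comp G F) f)) :
  nat_isomorphic (functor_comp (localized_functor GV) (localized_functor FW))
                 (localized_functor GFW).
Proof.
pose H := functor_comp (localized_functor GV) (localized_functor FW).
pose i x : hom (H x) (localized_functor GFW x) := idm (G (F x) : localization T).
have n (x y : localization W) (f : hom x y) :
    i y \mo fmap H f = fmap (localized_functor GFW) f \mo i x.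
  apply: (@loc_natural _ _ _ H (localized_functor GFW) i) => {}x {}y {}f.
  rewrite [LHS]comp1m [RHS]compm1 [RHS]localized_functorE.
  exact: etrans (congr1 (fmap (localized_functor GV)) (localized_functorE _ _))
    (localized_functorE _ _).
exists (@NatTrans _ _ H (localized_functor GFW) i n) => x.
exact: is_iso_id.
Qed.

Lemma localized_functor_id (C : category) (W : forall x y : C, hom x y -> Prop)
    (idW : forall x y (f : hom x y), W x y f -> W _ _ (fmap (functor_id C) f)) :
  nat_isomorphic (localized_functor idW) (functor_id (localization W)).
Proof.
pose i x : hom (localized_functor idW x) (functor_id (localization W) x) :=
  idm (x : localization W).
have n (x y : localization W) (f : hom x y) :
    i y \mo fmap (localized_functor idW) f = fmap (functor_id (localization W)) f \mo i x.
  apply: (@loc_natural _ _ _ (localized_functor idW) (functor_id (localization W)) i)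
    => {}x {}y {}f.
  by rewrite [LHS]comp1m [RHS]compm1 localized_functorE.
exists (@NatTrans _ _ (localized_functor idW) (functor_id (localization W)) i n) => x.
exact: is_iso_id.
Qed.

Section HomologyFunctor.
Variable A : abelian.
Implicit Types X Y Z : complex A.

Lemma homology_map_id X n : homology_map (chain_id X) n = idm _.
Proof.
apply: cokerm_epi; rewrite homology_mapE comp1m -[RHS]compm1; congr (_ \mo _).
by apply: kerm_mono; rewrite cycle_mapE comp1m compm1.
Qed.

Lemma homology_map_comp X Y Z (g : chain_map Y Z) (f : chain_map X Y) n :
  homology_map (chain_comp g f) n = homology_map g n \mo homology_map f n.
Proof.
apply: cokerm_epi; rewrite homology_mapE -compA homology_mapE compA homology_mapE -compA.
congr (_ \mo _); apply: kerm_mono.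
by rewrite cycle_mapE compA cycle_mapE -!compA cycle_mapE.
Qed.

Lemma quasi_iso_comp (X Y Z : complex_cat A) (g : hom Y Z) (f : hom X Y) :
  quasi_iso g -> quasi_iso f -> quasi_iso (g \mo f).
Proof. by move=> qg qf n; rewrite homology_map_comp; apply: is_iso_comp. Qed.

Lemma iso_quasi_iso (X Y : complex_cat A) (f : hom X Y) : is_iso f -> quasi_iso f.
Proof.
move=> [g [gf fg]] n; exists (homology_map g n).
rewrite -!homology_map_comp.
by rewrite (gf : chain_comp g f = chain_id X) (fg : chain_comp f g = chain_id Y)
  !homology_map_id.
Qed.

(** The homology of a shift is, naturally, the homology one degree higher; this is the converse of
    [quasi_iso_shift]. *)
Lemma quasi_iso_unshift_shift (X Y : complex_cat A) (f : hom X Y) :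
  quasi_iso (fmap (complex_shift A) f) -> quasi_iso f.
Proof.
move=> qf m; have [n ->] := succz_surj m.
have [a [b [ba ab aE]]] := homology_shift X n.
have [a' [b' [ba' ab' aE']]] := homology_shift Y n.
have nat : homology_map (shift_map f) n \mo a = a' \mo homology_map f (succz n).
  apply: cokerm_epi; rewrite -!compA aE [in LHS]compA !coker_descE.
  rewrite (compA a') aE' -!compA; congr (_ \mo _).
  by apply: kerm_mono; rewrite !compA !ker_liftE -!compA !ker_liftE.
have -> : homology_map f (succz n) = b' \mo (homology_map (shift_map f) n \mo a).
  by rewrite nat compA ba' comp1m.
apply: is_iso_comp; first by exists a'.
by apply: is_iso_comp; [apply: qf | exists b].
Qed.

End HomologyFunctor.

(** * The shift is an equivalence of the derived category *)

Section Unshift.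
Variable A : abelian.
Implicit Types X Y : complex A.

(* [succz (predz n)] is only propositionally equal to [n], hence these transports. *)
Definition cxcast X (m n : int) (e : m = n) : hom (X m) (X n) :=
  match e in _ = k return hom (X m) (X k) with erefl => idm _ end.

Lemma cxcast_id X n (e : n = n) : cxcast X e = idm _.
Proof. by rewrite (eq_irrelevance e erefl). Qed.

Lemma cxcast_comp X m n k (e : m = n) (e' : n = k) (e'' : m = k) :
  cxcast X e' \mo cxcast X e = cxcast X e''.
Proof. by subst k n; rewrite !cxcast_id comp1m. Qed.

Lemma cxcast_diff X m n (e : m = n) (e' : succz m = succz n) :
  diff X n \mo cxcast X e = cxcast X e' \mo diff X m.
Proof. by subst n; rewrite !cxcast_id comp1m compm1. Qed.

Lemma cxcast_map X Y (f : chain_map X Y) m n (e : m = n) :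
  f n \mo cxcast X e = cxcast Y e \mo f m.
Proof. by subst n; rewrite !cxcast_id comp1m compm1. Qed.

Lemma cxcast_iso X m n (e : m = n) : is_iso (cxcast X e).
Proof. by exists (cxcast X (esym e)); rewrite !(cxcast_comp _ _ _ erefl). Qed.

Definition predz (n : int) : int := n - 1.

Lemma succz_pred n : succz (predz n) = n. Proof. exact: subrK. Qed.
Lemma predz_succ n : predz (succz n) = n. Proof. exact: addrK. Qed.
Lemma succz_predC n : succz (predz n) = predz (succz n).
Proof. by rewrite succz_pred predz_succ. Qed.

(** The sign undoes the one of [shift_ob]; the transport corrects the target
    [X (succz (predz n))]. *)
Definition unshift_diff X n : hom (X (predz n)) (X (predz (succz n))) :=
  - (cxcast X (succz_predC n) \mo diff X (predz n)).

Fact unshift_diffK X n : unshift_diff X (succz n) \mo unshift_diff X n = 0.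
Proof.
rewrite compNm compmN opprK compA -(compA _ (diff X _)).
rewrite (cxcast_diff X (succz_predC n) (congr1 succz (succz_predC n))).
by rewrite -!compA diffK !compm0.
Qed.

Definition unshift_ob X : complex A := Complex (@unshift_diffK X).

Fact unshift_map_diff X Y (f : chain_map X Y) n :
  f (predz (succz n)) \mo unshift_diff X n = unshift_diff Y n \mo f (predz n).
Proof.
by rewrite compmN compNm compA cxcast_map -!compA cm_diff.
Qed.

Definition unshift_map X Y (f : chain_map X Y) : chain_map (unshift_ob X) (unshift_ob Y) :=
  @ChainMap A (unshift_ob X) (unshift_ob Y) (fun n => f (predz n)) (unshift_map_diff f).

Definition complex_unshift : functor (complex_cat A) (complex_cat A).
Proof.
refine (@Functor (complex_cat A) (complex_cat A) unshift_ob unshift_map _ _).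
- by move=> X; apply: chain_mapP.
- by move=> X Y Z g f; apply: chain_mapP.
Defined.

Fact shift_unshift_diff X n :
  cxcast X (predz_succ (succz n)) \mo diff (shift_ob (unshift_ob X)) n =
  diff X n \mo cxcast X (predz_succ n).
Proof.
rewrite /= opprK compA (cxcast_comp _ _ _ (congr1 succz (predz_succ n))).
exact/esym/cxcast_diff.
Qed.

Definition shift_unshift X : chain_map (shift_ob (unshift_ob X)) X :=
  @ChainMap A (shift_ob (unshift_ob X)) X _ (shift_unshift_diff X).

Lemma cxcast_shift X m n (e : m = n) :
  cxcast (shift_ob X) e = cxcast X (congr1 succz e).
Proof. by case: n / e. Qed.

Fact unshift_shift_diff X n :
  cxcast X (succz_pred (succz n)) \mo diff (unshift_ob (shift_ob X)) n =
  diff X n \mo cxcast X (succz_pred n).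
Proof.
rewrite /= /unshift_diff /= !compmN opprK cxcast_shift compA.
rewrite (cxcast_comp _ _ _ (congr1 succz (succz_pred n))).
exact/esym/cxcast_diff.
Qed.

Definition unshift_shift X : chain_map (unshift_ob (shift_ob X)) X :=
  @ChainMap A (unshift_ob (shift_ob X)) X _ (unshift_shift_diff X).

Lemma shift_unshift_iso X :
  is_iso (shift_unshift X : hom (shift_ob (unshift_ob X) : complex_cat A) X).
Proof. by apply: complex_iso => n; apply: cxcast_iso. Qed.

Lemma unshift_shift_iso X :
  is_iso (unshift_shift X : hom (unshift_ob (shift_ob X) : complex_cat A) X).
Proof. by apply: complex_iso => n; apply: cxcast_iso. Qed.

Fact shift_unshift_natural (X Y : complex_cat A) (f : hom X Y) :
  (shift_unshift Y : hom (shift_ob (unshift_ob Y) : complex_cat A) Y) \mo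
    fmap (functor_comp (complex_shift A) complex_unshift) f =
  fmap (functor_id (complex_cat A)) f \mo shift_unshift X.
Proof. by apply: chain_mapP => n; apply: esym (cxcast_map f _). Qed.

Fact unshift_shift_natural (X Y : complex_cat A) (f : hom X Y) :
  (unshift_shift Y : hom (unshift_ob (shift_ob Y) : complex_cat A) Y) \mo
    fmap (functor_comp complex_unshift (complex_shift A)) f =
  fmap (functor_id (complex_cat A)) f \mo unshift_shift X.
Proof. by apply: chain_mapP => n; apply: esym (cxcast_map f _). Qed.

(** The shift reflects quasi-isomorphisms, and the shift of the unshift of [f] is conjugate to [f]
    by [shift_unshift]. *)
Lemma quasi_iso_unshift (X Y : complex_cat A) (f : hom X Y) :
  quasi_iso f -> quasi_iso (fmap complex_unshift f).
Proof.
move=> qf; apply: quasi_iso_unshift_shift.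
have [g [gs sg]] := shift_unshift_iso Y.
have -> : fmap (complex_shift A) (fmap complex_unshift f) = g \mo (f \mo shift_unshift X).
  by rewrite -[X in g \mo X](shift_unshift_natural f) compA gs comp1m.
apply: quasi_iso_comp; first by apply: iso_quasi_iso; exists (shift_unshift Y).
by apply: quasi_iso_comp => //; apply/iso_quasi_iso/shift_unshift_iso.
Qed.

Definition derived_unshift : functor (derived_category A) (derived_category A) :=
  @localized_functor _ _ (@quasi_iso A) (@quasi_iso A) _ quasi_iso_unshift.

Lemma is_equivalence_derived_shift : is_equivalence (@derived_shift A).
Proof.
have idq (X Y : complex_cat A) (f : hom X Y) :
  quasi_iso f -> quasi_iso (fmap (functor_id (complex_cat A)) f) by [].
exists derived_unshift; split; apply: nat_isomorphic_trans (localized_functor_id idq).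
- apply: nat_isomorphic_trans (localized_functor_comp _ _ _) _.
    by move=> X Y f qf; apply/quasi_iso_unshift/quasi_iso_shift.
  move=> GFW.
  apply: (@localized_nat_isomorphic _ _ _ _ _ _ _ _ (@NatTrans _ _
    (functor_comp complex_unshift (complex_shift A)) (functor_id (complex_cat A)) _
    unshift_shift_natural)) => X.
  exact/iso_quasi_iso/unshift_shift_iso.
- apply: nat_isomorphic_trans (localized_functor_comp _ _ _) _.
    by move=> X Y f qf; apply/quasi_iso_shift/quasi_iso_unshift.
  move=> GFW.
  apply: (@localized_nat_isomorphic _ _ _ _ _ _ _ _ (@NatTrans _ _
    (functor_comp (complex_shift A) complex_unshift) (functor_id (complex_cat A)) _
    shift_unshift_natural)) => X.
  exact/iso_quasi_iso/shift_unshift_iso.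
Qed.

End Unshift.

(** * Bicartesian squares *)

Section Bicartesian.
Variable A : abelian.
Implicit Types x y z w t : A.

(** Exactness of [0 -> x -> y + z -> w -> 0] with maps [(f, g)] and [(h, - l)]. *)
Record bicartesian x y z w (f : hom x y) (g : hom x z) (h : hom y w) (l : hom z w) :
    Prop := Bicartesian {
  bicartesian_ker : is_kernel (h \mo pr1 y z - l \mo pr2 y z) (bpair f g);
  bicartesian_epi : epi (h \mo pr1 y z - l \mo pr2 y z) }.

Section Theory.
Variables (x y z w : A) (f : hom x y) (g : hom x z) (h : hom y w) (l : hom z w).
Hypothesis bic : bicartesian f g h l.

Lemma bicartesian_comm : h \mo f = l \mo g.
Proof.
have [E _] := bicartesian_ker bic; apply/subr0_eq; rewrite -[RHS]E.
by rewrite compDl compNm -!compA pr1_bpair pr2_bpair.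
Qed.

Lemma bicartesian_inj t (a b : hom t x) : f \mo a = f \mo b -> g \mo a = g \mo b -> a = b.
Proof.
move=> E1 E2; apply: (is_kernel_mono (bicartesian_ker bic)).
by rewrite !bpair_comp E1 E2.
Qed.

Lemma bicartesian_lift t (b : hom t y) (c : hom t z) : h \mo b = l \mo c ->
  exists a : hom t x, f \mo a = b /\ g \mo a = c.
Proof.
move=> E; have [_ lift] := bicartesian_ker bic.
have E0 : (h \mo pr1 y z - l \mo pr2 y z) \mo bpair b c = 0.
  by rewrite compDl compNm -!compA pr1_bpair pr2_bpair E subrr.
have [a [aE _]] := lift _ _ E0; exists a.
by rewrite bpair_comp in aE; apply: bpair_inj.
Qed.

Lemma bicartesian_cover t (d : hom t w) :
  exists (t' : A) (p : hom t' t) (b : hom t' y) (c : hom t' z),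
    epi p /\ h \mo b - l \mo c = d \mo p.
Proof.
have [t' [p [e [ep E]]]] := epi_pullback d (bicartesian_epi bic).
exists t', p, (pr1 y z \mo e), (pr2 y z \mo e); split=> //.
by rewrite -E compDl compNm !compA.
Qed.
End Theory.

(** This lemma and the next treat the two pairs of opposite sides; the squares of diagrams below
    fall under one or the other at each point of the poset. *)
Lemma bicartesian_iso1 x y z w (f : hom x y) (g : hom x z) (h : hom y w) (l : hom z w) :
  h \mo f = l \mo g -> is_iso f -> is_iso l -> bicartesian f g h l.
Proof.
move=> E [f' [f'f ff']] [l' [l'l ll']]; split.
  split=> [|t u u0]; first by rewrite compDl compNm -!compA pr1_bpair pr2_bpair E subrr.
  have {u0} u0 : h \mo (pr1 y z \mo u) = l \mo (pr2 y z \mo u).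
    by apply/subr0_eq; rewrite -[RHS]u0 compDl compNm -!compA.
  exists (f' \mo (pr1 y z \mo u)); split; last first.
    by move=> v <-; rewrite bpair_comp pr1_bpair compA f'f comp1m.
  rewrite bpair_comp -[RHS]bpair_eta; congr bpair; first by rewrite compA ff' comp1m.
  rewrite -[LHS]comp1m -l'l -compA (compA l) -E -(compA h) (compA f) ff' comp1m.
  by rewrite u0 compA l'l comp1m.
apply: (@epi_cancel _ _ _ _ _ (in2 y z \mo (- l'))).
rewrite compA compDl compNm -!compA pr1_in2 pr2_in2 compm0 compm1 sub0r.
by rewrite compNm compmN opprK ll'; apply: epi_id.
Qed.

Lemma bicartesian_iso2 x y z w (f : hom x y) (g : hom x z) (h : hom y w) (l : hom z w) :
  h \mo f = l \mo g -> is_iso g -> is_iso h -> bicartesian f g h l.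
Proof.
move=> E [g' [g'g gg']] [h' [h'h hh']]; split.
  split=> [|t u u0]; first by rewrite compDl compNm -!compA pr1_bpair pr2_bpair E subrr.
  have {u0} u0 : h \mo (pr1 y z \mo u) = l \mo (pr2 y z \mo u).
    by apply/subr0_eq; rewrite -[RHS]u0 compDl compNm -!compA.
  exists (g' \mo (pr2 y z \mo u)); split; last first.
    by move=> v <-; rewrite bpair_comp pr2_bpair compA g'g comp1m.
  rewrite bpair_comp -[RHS]bpair_eta; congr bpair; last by rewrite compA gg' comp1m.
  rewrite -[LHS]comp1m -h'h -compA (compA h) E -(compA l) (compA g) gg' comp1m.
  by rewrite -u0 compA h'h comp1m.
apply: (@epi_cancel _ _ _ _ _ (in1 y z \mo h')).
rewrite compA compDl compNm -!compA pr1_in1 pr2_in1 compm0 compm1 subr0.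
by rewrite hh'; apply: epi_id.
Qed.

(* Exactness of the total complex X -> Y + Z -> W of a bicartesian square. *)
Lemma bicartesian_total (X Y Z W : complex A) (f : chain_map X Y) (g : chain_map X Z)
    (h : chain_map Y W) (l : chain_map Z W) :
  (forall n, bicartesian (f n) (g n) (h n) (l n)) ->
  forall n t (x : hom t (X (succz (succz n)))) (y : hom t (Y (succz n)))
    (z : hom t (Z (succz n))) (w : hom t (W n)),
  f _ \mo x = diff Y _ \mo y -> g _ \mo x = - (diff Z _ \mo z) ->
  h _ \mo y + l _ \mo z + diff W _ \mo w = 0 ->
  exists (t' : A) (p : hom t' t) (x' : hom t' (X (succz n))) (y' : hom t' (Y n))
    (z' : hom t' (Z n)), epi p /\
    [/\ diff X _ \mo x' = x \mo p, f _ \mo x' - diff Y _ \mo y' = y \mo p,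
        - (g _ \mo x') - diff Z _ \mo z' = z \mo p & h _ \mo y' + l _ \mo z' = w \mo p].
Proof.
move=> bic n t x y z w fx gx hyz.
(* Split [w] as [h y' - l z']. Then [y + d y'] and [- z + d z'] have the same image in [W], hence
   lift to a common [x']; the preimage is [(x', y', - z')], with no component in [W]. *)
have [t' [p [y' [z' [ep E]]]]] := bicartesian_cover (bic n) w.
have Eyz : h (succz n) \mo (y \mo p + diff Y n \mo y') =
    l (succz n) \mo (- (z \mo p) + diff Z n \mo z').
  apply/subr0_eq; rewrite -[RHS](comp0m _ p) -hyz !compDl -!compA -E !compDr !compmN.
  by rewrite !(compA _ (diff _ _)) !cm_diff opprD opprK addrACA -!compA.
have [x' [fx' gx']] := bicartesian_lift (bic _) Eyz.
exists t', p, x', y', (- z'); split=> //; split.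
- apply: (bicartesian_inj (bic _)).
    rewrite compA cm_diff -compA fx' compDr (compA _ _ y') diffK comp0m addr0.
    by rewrite (compA (f _)) fx compA.
  rewrite compA cm_diff -compA gx' compDr (compA _ _ z') diffK comp0m addr0.
  by rewrite (compA (g _)) gx compNm compmN compA.
- by rewrite fx' addrK.
- by rewrite gx' opprD opprK compmN opprK addrAC addrK.
- by rewrite compmN.
Qed.

End Bicartesian.

(** * Mutually inverse cone functors *)

Lemma nt_naturalE (C D : category) (F G : functor C D) (a : nat_trans F G)
    (x y : C) (f : hom x y) (t : D) (u : hom t (F x)) :
  fmap G f \mo (a x \mo u) = a y \mo (fmap F f \mo u).
Proof. by rewrite !compA nt_natural. Qed.

Section ExactElements.
Variables (A B : abelian) (U : exact_functor A B) (x y : A) (t : B).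

Lemma ef_pr1_in1E (a : hom t (U x)) : fmap U (pr1 x y) \mo (fmap U (in1 x y) \mo a) = a.
Proof. by rewrite compA ef_pr1_in1 comp1m. Qed.
Lemma ef_pr2_in2E (a : hom t (U y)) : fmap U (pr2 x y) \mo (fmap U (in2 x y) \mo a) = a.
Proof. by rewrite compA ef_pr2_in2 comp1m. Qed.
Lemma ef_pr1_in2E (a : hom t (U y)) : fmap U (pr1 x y) \mo (fmap U (in2 x y) \mo a) = 0.
Proof. by rewrite compA ef_pr1_in2 comp0m. Qed.
Lemma ef_pr2_in1E (a : hom t (U x)) : fmap U (pr2 x y) \mo (fmap U (in1 x y) \mo a) = 0.
Proof. by rewrite compA ef_pr2_in1 comp0m. Qed.

Definition ef_inE := (ef_pr1_in1E, ef_pr2_in2E, ef_pr1_in2E, ef_pr2_in1E).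
End ExactElements.

Section ComplexMapChain.
Variables (A B : abelian) (U : exact_functor A B) (X Y : complex A) (f : chain_map X Y).

Fact complex_map_chain_diff n :
  fmap U (f (succz n)) \mo fmap U (diff X n) = fmap U (diff Y n) \mo fmap U (f n).
Proof. by rewrite -!fmap_comp cm_diff. Qed.

Definition complex_map_chain : chain_map (complex_map U X) (complex_map U Y) :=
  @ChainMap B (complex_map U X) (complex_map U Y) _ complex_map_chain_diff.
End ComplexMapChain.

Section ConeObElements.
Variables (A B C : abelian) (U V : exact_functor A B) (al : nat_trans U V).
Variables (F : exact_functor B C) (X : complex A) (n : int) (t : C).

Lemma ef_pr1_diff_cone_ob (a : hom t (F (cone_ob al X n))) :
  fmap F (pr1 (U (X (succz (succz n)))) (V (X (succz n)))) \mo
    (fmap F (diff (cone_ob al X) n) \mo a) =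
  - (fmap F (fmap U (diff X (succz n))) \mo
     (fmap F (pr1 (U (X (succz n))) (V (X n))) \mo a)).
Proof. exact: (@ef_pr1_diff_cone _ _ F _ _ (complex_map_nat al X) n t a). Qed.

Lemma ef_pr2_diff_cone_ob (a : hom t (F (cone_ob al X n))) :
  fmap F (pr2 (U (X (succz (succz n)))) (V (X (succz n)))) \mo
    (fmap F (diff (cone_ob al X) n) \mo a) =
  fmap F (al (X (succz n))) \mo (fmap F (pr1 (U (X (succz n))) (V (X n))) \mo a) +
  fmap F (fmap V (diff X n)) \mo (fmap F (pr2 (U (X (succz n))) (V (X n))) \mo a).
Proof. exact: (@ef_pr2_diff_cone _ _ F _ _ (complex_map_nat al X) n t a). Qed.

Lemma ef_pr1_cone_map (Y : complex A) (f : chain_map X Y) (a : hom t (F (cone_ob al X n))) :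
  fmap F (pr1 (U (Y (succz n))) (V (Y n))) \mo (fmap F (cone_map al f n) \mo a) =
  fmap F (fmap U (f (succz n))) \mo (fmap F (pr1 (U (X (succz n))) (V (X n))) \mo a).
Proof. by rewrite !compA -!fmap_comp pr1_bpair. Qed.

Lemma ef_pr2_cone_map (Y : complex A) (f : chain_map X Y) (a : hom t (F (cone_ob al X n))) :
  fmap F (pr2 (U (Y (succz n))) (V (Y n))) \mo (fmap F (cone_map al f n) \mo a) =
  fmap F (fmap V (f n)) \mo (fmap F (pr2 (U (X (succz n))) (V (X n))) \mo a).
Proof. by rewrite !compA -!fmap_comp pr2_bpair. Qed.

Lemma ef_cone_ob_ext (f g : hom t (F (cone_ob al X n))) :
  fmap F (pr1 (U (X (succz n))) (V (X n))) \mo f =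
  fmap F (pr1 (U (X (succz n))) (V (X n))) \mo g ->
  fmap F (pr2 (U (X (succz n))) (V (X n))) \mo f =
  fmap F (pr2 (U (X (succz n))) (V (X n))) \mo g -> f = g.
Proof. exact: ef_bip_ext. Qed.
End ConeObElements.

Section ConeEquivalence.
Variables (A B : abelian).
Variables (U V : exact_functor A B) (al : nat_trans U V).
Variables (U' V' : exact_functor B A) (al' : nat_trans U' V').
Hypothesis U'U0 : forall (x t : A) (f : hom t (U' (U x))), f = 0.
Hypothesis VV'0 : forall (y t : B) (f : hom t (V (V' y))), f = 0.
Variables (i : nat_trans (functor_id A) (functor_comp U' V))
          (k : nat_trans (functor_id A) (functor_comp V' U)).
Hypothesis bic : forall x, bicartesian (i x) (k x) (al' (V x)) (fmap V' (al x)).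
Variables (p : nat_trans (functor_comp V U') (functor_id B))
          (q : nat_trans (functor_comp U V') (functor_id B)).
Hypothesis bic' : forall y, bicartesian (al (U' y)) (fmap U (al' y)) (p y) (q y).

Local Notation Phi := (cone_ob al).
Local Notation Phi' := (cone_ob al').

Local Notation s2 n := (succz (succz n)).
Local Notation s3 n := (succz (s2 n)).
Local Notation s4 n := (succz (s3 n)).
Local Notation s5 n := (succz (s4 n)).

Let iE (x y : A) (f : hom x y) (t : A) (u : hom t x) :
  fmap U' (fmap V f) \mo (i x \mo u) = i y \mo (f \mo u).
Proof. exact: (nt_naturalE i). Qed.
Let kE (x y : A) (f : hom x y) (t : A) (u : hom t x) :
  fmap V' (fmap U f) \mo (k x \mo u) = k y \mo (f \mo u).
Proof. exact: (nt_naturalE k). Qed.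

Section Unit.
Variable X : complex A.

(** The sign on [k] makes the two images in [V' V X] cancel, by commutativity of the square. *)
Definition unit_comp n : hom (shift_ob X n) (Phi' (Phi X) n) :=
  bpair (fmap U' (in2 (U (X (s2 n))) (V (X (succz n)))) \mo i (X (succz n)))
    (- (fmap V' (in1 (U (X (succz n))) (V (X n))) \mo k (X (succz n)))).

Lemma unit_compE n t (x : hom t (X (succz n))) : unit_comp n \mo x =
  bpair (fmap U' (in2 (U (X (s2 n))) (V (X (succz n)))) \mo (i _ \mo x))
    (- (fmap V' (in1 (U (X (succz n))) (V (X n))) \mo (k _ \mo x))).
Proof. by rewrite [LHS]bpair_comp compNm -!compA. Qed.

Fact unit_diff n :
  unit_comp (succz n) \mo diff (shift_ob X) n = diff (Phi' (Phi X)) n \mo unit_comp n.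
Proof.
rewrite [RHS]diff_cone_ob_bpair [LHS]unit_compE.
rewrite (_ : diff (shift_ob X) n = - diff X (succz n)) // !compmN opprK.
congr bpair; apply: ef_cone_ob_ext; rewrite ?compmN ?compDr.
- by rewrite ef_pr1_diff_cone_ob !ef_inE compm0 !oppr0.
- rewrite ef_pr2_diff_cone_ob !ef_inE compm0 add0r.
  by rewrite -[i _ in RHS]compm1 iE compm1.
- rewrite (nt_naturalE al') compmN ef_pr1_diff_cone_ob !ef_inE compm0 add0r opprK.
  by rewrite -[k _ in RHS]compm1 kE compm1.
- rewrite (nt_naturalE al') compmN ef_pr2_diff_cone_ob !ef_inE compm0 addr0.
  by rewrite (bicartesian_comm (bic _)) subrr.
Qed.

Definition unit_map : chain_map (shift_ob X) (Phi' (Phi X)) := ChainMap unit_diff.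

Let square_f := @ChainMap A X (complex_map U' (complex_map V X))
  (fun n => i (X n)) (fun n => nt_natural i (diff X n)).
Let square_g := @ChainMap A X (complex_map V' (complex_map U X))
  (fun n => k (X n)) (fun n => nt_natural k (diff X n)).
Let square_h := complex_map_nat al' (complex_map V X).
Let square_l := complex_map_chain V' (complex_map_nat al X).

(** Without its zero summand [U' U X], the cone of [unit_map] is, up to signs, the total complex of
    [X -> U' V X + V' U X -> V' V X], and [bicartesian_total] applies. *)
Lemma unit_quasi_iso :
  quasi_iso (unit_map : hom (shift_ob X : complex_cat A) (Phi' (Phi X))).
Proof.
apply: acyclic_quasi_iso => n t z; rewrite -(bpair_eta z).
move: (pr1 _ _ \mo z) (pr2 _ _ \mo z) => {}x {}z; rewrite -(bpair_eta z).
move: (pr1 _ _ \mo z) (pr2 _ _ \mo z) => c1 c2 {z}.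
rewrite [X in X = _ -> _]diff_cone_bpair [unit_map _ \mo _]unit_compE.
rewrite (diff_cone_ob_bpair al' c1 c2) bpairD.
move=> z0; have [E0 E12] := bpair_inj (etrans z0 (esym (bpair0 _ _ _))).
have {z0 E12} [E1 E2] := bpair_inj (etrans E12 (esym (bpair0 _ _ _))).
(* [b], [a] and [c] are the components in [U' V X], [V' U X] and [V' V X]; the remaining one, in
   [U' U X], vanishes. *)
pose b := fmap U' (pr2 (U (X (s3 n))) (V (X (s2 n)))) \mo c1.
pose a := fmap V' (pr1 (U (X (s2 n))) (V (X (succz n)))) \mo c2.
pose c := fmap V' (pr2 (U (X (s2 n))) (V (X (succz n)))) \mo c2.
have c1E : c1 = fmap U' (in2 _ _) \mo b.
  by apply: ef_cone_ob_ext; [rewrite (U'U0 (_ \mo c1)) [RHS]U'U0 | rewrite ef_inE].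
have c2E : c2 = fmap V' (in1 _ _) \mo a + fmap V' (in2 _ _) \mo c.
  by apply: ef_cone_ob_ext; rewrite compDr !ef_inE ?addr0 ?add0r.
clearbody a b c; subst c1 c2.
have fx : i _ \mo x = fmap U' (fmap V (diff X (s2 n))) \mo b.
  have := congr1 (comp (fmap U' (pr2 _ _))) E1.
  rewrite compm0 compDr compmN [X in _ - X]ef_pr2_diff_cone_ob !ef_inE compm0 add0r.
  exact: subr0_eq.
have gx : k _ \mo x = - (fmap V' (fmap U (diff X (s2 n))) \mo a).
  have := congr1 (comp (fmap V' (pr1 _ _))) E2.
  rewrite compm0 !compDr compmN (nt_naturalE al') !ef_pr1_diff_cone_ob !ef_inE.
  rewrite !compm0 subr0 add0r.
  by move/eqP; rewrite -opprD oppr_eq0 addr_eq0 => /eqP.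
have hw : al' _ \mo b + fmap V' (al _) \mo a +
    fmap V' (fmap V (diff X (succz n))) \mo c = 0.
  have := congr1 (comp (fmap V' (pr2 _ _))) E2.
  rewrite compm0 !compDr compmN (nt_naturalE al') !ef_pr2_diff_cone_ob !ef_inE.
  by rewrite !compm0 oppr0 add0r !add0r addr0 !addrA.
have [t' [pi [x' [b' [a' [epi [R1 R2 R3 R4]]]]]]] :=
  bicartesian_total (f := square_f) (g := square_g) (h := square_h) (l := square_l)
    (fun n => bic (X n)) fx gx hw.
exists t', pi, (bpair x' (bpair (fmap U' (in2 _ _) \mo b') (fmap V' (in1 _ _) \mo a'))).
split=> //; rewrite [LHS]diff_cone_bpair [unit_map _ \mo _]unit_compE.
rewrite (diff_cone_ob_bpair al' (_ \mo b') _) bpairD (bpair_comp x) (bpair_comp (_ \mo b)).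
congr (bpair _ (bpair _ _)).
- by rewrite compNm opprK.
- apply: ef_cone_ob_ext; rewrite -!compA compDr compmN.
    by rewrite ef_pr1_diff_cone_ob !ef_inE compm0 !oppr0 addr0.
  by rewrite ef_pr2_diff_cone_ob !ef_inE compm0 add0r.
- apply: ef_cone_ob_ext; rewrite compDl -!compA !compDr compmN (nt_naturalE al').
    by rewrite ef_pr1_diff_cone_ob !ef_inE compm0 add0r addr0 -R3.
  by rewrite ef_pr2_diff_cone_ob !ef_inE compm0 oppr0 !add0r addr0.
Qed.
End Unit.
Let pE (x y : B) (f : hom x y) (t : B) (u : hom t (V (U' x))) :
  p y \mo (fmap V (fmap U' f) \mo u) = f \mo (p x \mo u).
Proof. exact/esym/(nt_naturalE p). Qed.
Let qE (x y : B) (f : hom x y) (t : B) (u : hom t (U (V' x))) :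
  q y \mo (fmap U (fmap V' f) \mo u) = f \mo (q x \mo u).
Proof. exact/esym/(nt_naturalE q). Qed.

Section Counit.
Variable Y : complex B.

Definition counit_comp n : hom (Phi (Phi' Y) n) (shift_ob Y n) :=
  q (Y (succz n)) \mo
    (fmap U (pr2 (U' (Y (s2 n))) (V' (Y (succz n)))) \mo pr1 _ _) +
  p (Y (succz n)) \mo (fmap V (pr1 (U' (Y (succz n))) (V' (Y n))) \mo pr2 _ _).

Lemma counit_compE n t (a : hom t (U (Phi' Y (succz n)))) (b : hom t (V (Phi' Y n))) :
  counit_comp n \mo bpair a b =
  q (Y (succz n)) \mo (fmap U (pr2 (U' (Y (s2 n))) (V' (Y (succz n)))) \mo a) +
  p (Y (succz n)) \mo (fmap V (pr1 (U' (Y (succz n))) (V' (Y n))) \mo b).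
Proof. by rewrite [LHS]compDl -!compA pr1_bpair pr2_bpair. Qed.

Fact counit_diff n :
  counit_comp (succz n) \mo diff (Phi (Phi' Y)) n = diff (shift_ob Y) n \mo counit_comp n.
Proof.
apply: bip_elim => t a b.
rewrite -!compA diff_cone_ob_bpair !counit_compE.
rewrite (_ : diff (shift_ob Y) n = - diff Y (succz n)) //.
rewrite compDr !compmN (nt_naturalE al) ef_pr1_diff_cone_ob ef_pr2_diff_cone_ob.
rewrite !compDr compmN qE pE opprD addrACA !compNm.
rewrite (compA (q _)) (compA (p _)) (bicartesian_comm (bic' _)) addNr add0r.
by [].
Qed.

Definition counit_map : chain_map (Phi (Phi' Y)) (shift_ob Y) := ChainMap counit_diff.

Let square_f := complex_map_nat al (complex_map U' Y).
Let square_g := complex_map_chain U (complex_map_nat al' Y).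
Let square_h := @ChainMap B (complex_map V (complex_map U' Y)) Y
  (fun n => p (Y n)) (fun n => nt_natural p (diff Y n)).
Let square_l := @ChainMap B (complex_map U (complex_map V' Y)) Y
  (fun n => q (Y n)) (fun n => nt_natural q (diff Y n)).

(** Dual to the unit: without the zero summand [V V' Y], the cone is, up to signs, the total complex
    of [U U' Y -> V U' Y + U V' Y -> Y]. *)
Lemma counit_quasi_iso :
  quasi_iso (counit_map : hom (Phi (Phi' Y) : complex_cat B) (shift_ob Y)).
Proof.
apply: acyclic_quasi_iso => n t z; rewrite -(bpair_eta z).
move: (pr1 _ _ \mo z) (pr2 _ _ \mo z) => {}z w; rewrite -(bpair_eta z).
move: (pr1 _ _ \mo z) (pr2 _ _ \mo z) => c1 c2 {z}.
rewrite [X in X = _ -> _]diff_cone_bpair [counit_map _ \mo _]counit_compE.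
rewrite (diff_cone_ob_bpair al c1 c2).
move=> z0; have [E01 E2] := bpair_inj (etrans z0 (esym (bpair0 _ _ _))).
rewrite -bpairN opprK in E01.
have {z0 E01} [E0 E1] := bpair_inj (etrans E01 (esym (bpair0 _ _ _))).
pose e := fmap U (pr1 (U' (Y (s4 n))) (V' (Y (s3 n)))) \mo c1.
pose g := fmap U (pr2 (U' (Y (s4 n))) (V' (Y (s3 n)))) \mo c1.
pose h := fmap V (pr1 (U' (Y (s3 n))) (V' (Y (s2 n)))) \mo c2.
have c1E : c1 = fmap U (in1 (U' (Y (s4 n))) (V' (Y (s3 n)))) \mo e +
    fmap U (in2 (U' (Y (s4 n))) (V' (Y (s3 n)))) \mo g.
  by apply: ef_cone_ob_ext; rewrite compDr !ef_inE ?addr0 ?add0r.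
have c2E : c2 = fmap V (in1 (U' (Y (s3 n))) (V' (Y (s2 n)))) \mo h.
  by apply: ef_cone_ob_ext; [rewrite ef_inE | rewrite (VV'0 (_ \mo c2)) [RHS]VV'0].
clearbody e g h; subst c1 c2.
have fx : al _ \mo e = fmap V (fmap U' (diff Y (s3 n))) \mo h.
  have := congr1 (comp (fmap V (pr1 (U' (Y (s4 n))) (V' (Y (s3 n))))))
    (etrans (esym (opprK _)) (etrans (congr1 _ E1) (oppr0 _))).
  rewrite compm0 !compDr !(nt_naturalE al) ef_pr1_diff_cone_ob !ef_inE compm0 addr0.
  exact: subr0_eq.
have gx : fmap U (al' _) \mo e = - (fmap U (fmap V' (diff Y (s3 n))) \mo g).
  have := congr1 (comp (fmap U (pr2 (U' (Y (s5 n))) (V' (Y (s4 n)))))) E0.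
  rewrite compm0 ef_pr2_diff_cone_ob !compDr !ef_inE !compm0 addr0 add0r.
  by move/eqP; rewrite addr_eq0 => /eqP.
(* The component [w] enters negated because the differential of [shift_ob Y] is [- diff Y]. *)
have hw : p _ \mo h + q _ \mo g + diff Y (s2 n) \mo (- w) = 0.
  rewrite -E2 compDr !ef_inE add0r [X in X + _ = _]addrC compmN -compNm.
  by [].
have [t' [pi [x' [b' [a' [epi [R1 R2 R3 R4]]]]]]] :=
  bicartesian_total (f := square_f) (g := square_g) (h := square_h) (l := square_l)
    (fun n => bic' (Y n)) fx gx hw.
(* The signs answer the negated [w]: [counit_map] sends this element to [- (p b' + q a')]. *)
exists t', pi, (bpair (bpair
  (- (fmap U (in1 (U' (Y (s3 n))) (V' (Y (s2 n)))) \mo x' +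
      fmap U (in2 (U' (Y (s3 n))) (V' (Y (s2 n)))) \mo a'))
  (- (fmap V (in1 (U' (Y (s2 n))) (V' (Y (succz n)))) \mo b'))) 0).
split=> //; rewrite [LHS]diff_cone_bpair [counit_map _ \mo _]counit_compE.
rewrite (diff_cone_ob_bpair al (- (_ + _)) _) (bpair_comp _ w) (bpair_comp (_ + _)).
rewrite -bpairN opprK !compmN.
congr (bpair (bpair _ _) _).
- apply: ef_cone_ob_ext; rewrite compmN compDl -!compA.
    rewrite ef_pr1_diff_cone_ob !compDr !ef_inE !addr0 compm0 addr0 opprK.
    exact: R1.
  rewrite ef_pr2_diff_cone_ob !compDr !ef_inE !compm0 addr0 !add0r opprD.
  exact: R3.
- rewrite opprD !opprK; apply: ef_cone_ob_ext;
    last by rewrite (VV'0 (_ \mo (_ + _))) [RHS]VV'0.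
  rewrite compDr (nt_naturalE al) ef_pr1_diff_cone_ob -compA !compDr !ef_inE compm0 addr0.
  exact: R2.
- rewrite !compDr !ef_inE !compm0 add0r addr0 -opprD addrC -[RHS]opprK -compNm.
  by congr (- _); apply: R4.
Qed.
End Counit.

Fact unit_natural (X Y : complex A) (f : chain_map X Y) :
  chain_comp (unit_map Y) (shift_map f) =
  chain_comp (cone_map al' (cone_map al f)) (unit_map X).
Proof.
apply: chain_mapP => n.
rewrite [LHS]unit_compE [RHS](@cone_map_bpair _ _ _ _ al' _ _ (cone_map al f)) compmN.
rewrite (_ : shift_map f n = f (succz n)) //.
congr (bpair _ (- _)); apply: ef_cone_ob_ext; rewrite !ef_inE.
- by rewrite ef_pr1_cone_map ef_inE compm0.
- by rewrite ef_pr2_cone_map ef_inE -[i _ in RHS]compm1 iE compm1.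
- by rewrite ef_pr1_cone_map ef_inE -[k _ in RHS]compm1 kE compm1.
- by rewrite ef_pr2_cone_map ef_inE compm0.
Qed.

Fact counit_natural (X Y : complex B) (f : chain_map X Y) :
  chain_comp (counit_map Y) (cone_map al (cone_map al' f)) =
  chain_comp (shift_map f) (counit_map X).
Proof.
apply: chain_mapP => n; apply: bip_elim => t a b.
rewrite -[LHS]compA [X in _ \mo X](@cone_map_bpair _ _ _ _ al _ _ (cone_map al' f)).
rewrite [LHS]counit_compE -[RHS]compA [X in _ = _ \mo X]counit_compE.
rewrite (_ : shift_map f n = f (succz n)) // compDr.
by rewrite ef_pr1_cone_map ef_pr2_cone_map pE qE.
Qed.

Lemma tri_equivalent_cones :
  tri_equivalent (derived A) (derived B) /\ tri_equivalent (derived B) (derived A).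
Proof.
have unitq (X Y : complex_cat A) (f : hom X Y) : quasi_iso f ->
  quasi_iso (fmap (functor_comp (cone_functor al') (cone_functor al)) f).
  by move=> /(cone_functor_quasi_iso al)/(cone_functor_quasi_iso al').
have counitq (X Y : complex_cat B) (f : hom X Y) : quasi_iso f ->
  quasi_iso (fmap (functor_comp (cone_functor al) (cone_functor al')) f).
  by move=> /(cone_functor_quasi_iso al')/(cone_functor_quasi_iso al).
have [eF eG] : is_equivalence (derived_cone al) /\ is_equivalence (derived_cone al').
  apply: (is_equivalence_up_to (@is_equivalence_derived_shift A)
    (@is_equivalence_derived_shift B)).
  - apply: nat_isomorphic_trans (localized_functor_comp _ _ unitq) _.
    apply: nat_isomorphic_sym.
    apply: (@localized_nat_isomorphic _ _ _ _ _ _ _ _ (@NatTrans _ _ (complex_shift A)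
      (functor_comp (cone_functor al') (cone_functor al)) unit_map unit_natural)).
    exact: unit_quasi_iso.
  - apply: nat_isomorphic_trans (localized_functor_comp _ _ counitq) _.
    apply: (@localized_nat_isomorphic _ _ _ _ _ _ _ _ (@NatTrans _ _
      (functor_comp (cone_functor al) (cone_functor al')) (complex_shift B)
      counit_map counit_natural)).
    exact: counit_quasi_iso.
by split; [apply: tri_equivalent_cone eF | apply: tri_equivalent_cone eG].
Qed.
End ConeEquivalence.

(** * Diagrams on posets *)

Section DiagramPointwise.
Variables (C : category) (A : abelian).
Implicit Types F G H K : diagram_cat C A.

Lemma nat_epi_pointwise F G (a : hom F G) : (forall x, epi (ntc a x)) -> epi a.
Proof. by move=> ea H g h E; apply: nat_transP => x; apply/ea/(nat_transE E x). Qed.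

Lemma bicartesian_pointwise F G H K (f : hom F G) (g : hom F H) (h : hom G K)
    (l : hom H K) :
  (forall x, bicartesian (ntc f x) (ntc g x) (ntc h x) (ntc l x)) ->
  bicartesian f g h l.
Proof.
move=> bic; split.
  by apply: nat_kernel => x; apply: (bicartesian_ker (bic x)).
by apply: nat_epi_pointwise => x; apply: (bicartesian_epi (bic x)).
Qed.

End DiagramPointwise.

(** * Partially defined monotone maps and restriction along them *)

Section OptionOrder.
Variables (d : Order.disp_t) (P : porderType d).

(* Undefined values are comparable to everything: they stand for zero objects. *)
Definition ole (o o' : option P) : bool :=
  if o is Some p then if o' is Some p' then (p <= p')%O else true else true.

Lemma ole_trans (o o' o'' : option P) :
  ole o o' -> ole o' o'' -> (o -> o'' -> o') -> ole o o''.
Proof.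
case: o o' o'' => [p|] [p'|] [p''|] //= h h' c; first exact: le_trans h'.
by have := c isT isT.
Qed.
End OptionOrder.

(** Convexity makes restriction with zero values functorial: if [q'] between two points of the
    domain were outside it, the composite through [q'] would vanish although the direct map need
    not. *)
Record partial_map (d d' : Order.disp_t) (Q : porderType d) (P : porderType d') : Type :=
  PartialMap {
    pm :> Q -> option P;
    pm_mono : forall q q', (q <= q')%O -> ole (pm q) (pm q');
    pm_convex : forall q q' q'', (q <= q')%O -> (q' <= q'')%O ->
      pm q -> pm q'' -> pm q' }.

Section OptionDiagram.
Variables (d : Order.disp_t) (P : porderType d) (A : abelian).
Implicit Types K L : diagram_cat (poset_cat P) A.

Definition oob K (o : option P) : A := if o is Some p then fobj K p else zob A.

Definition omap K (o o' : option P) : ole o o' -> hom (oob K o) (oob K o') :=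
  match o, o' return ole o o' -> hom (oob K o) (oob K o') with
  | Some p, Some p' => fun h => @fmap _ _ K p p' h
  | _, _ => fun _ => 0
  end.

Lemma omap_id K o (h : ole o o) : omap K h = idm _.
Proof.
case: o h => [p|] h /=; last by rewrite [RHS]zob_term.
by rewrite (bool_irrelevance h (lexx p)) (fmap_id K).
Qed.

Lemma omap_comp K (o o' o'' : option P) (c : o -> o'' -> o') (h : ole o o') (h' : ole o' o'')
  (h'' : ole o o'') : omap K h' \mo omap K h = omap K h''.
Proof.
case: o o' o'' c h h' h'' => [p|] [p'|] [p''|] c h h' h'' /=;
  rewrite ?comp0m ?compm0 //; last by have := c isT isT.
rewrite -(@fmap_comp _ _ K p p' p''); congr (fmap K _); exact: bool_irrelevance.
Qed.

Lemma omap_iso K o o' (h : ole o o') : o = o' -> is_iso (omap K h).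
Proof. by move=> E; subst o'; rewrite omap_id; apply: is_iso_id. Qed.

Definition ont K L (a : hom K L) (o : option P) : hom (oob K o) (oob L o) :=
  match o return hom (oob K o) (oob L o) with
  | Some p => ntc a p
  | None => 0
  end.

Lemma ont_natural K L (a : hom K L) o o' (h : ole o o') :
  ont a o' \mo omap K h = omap L h \mo ont a o.
Proof.
case: o o' h => [p|] [p'|] h /=; rewrite ?comp0m ?compm0 //.
exact: (nt_natural a).
Qed.

Lemma ont_id K o : ont (idm K) o = idm _.
Proof. by case: o => [p|] //=; rewrite [RHS]zob_term. Qed.

Lemma ont_comp K L M (b : hom L M) (a : hom K L) o :
  ont (b \mo a) o = ont b o \mo ont a o.
Proof. by case: o => [p|] //=; rewrite comp0m. Qed.

End OptionDiagram.

Section Reindex.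
Variables (d d' : Order.disp_t) (Q : porderType d) (P : porderType d') (A : abelian).
Local Notation AP := (diagram_cat (poset_cat P) A).
Local Notation AQ := (diagram_cat (poset_cat Q) A).

Section Functor.
Variable u : partial_map Q P.

Definition reindex_ob (K : AP) : AQ.
Proof.
refine (@Functor (poset_cat Q) A (fun q => oob K (u q))
  (fun q q' h => omap K (pm_mono u h)) _ _).
- by move=> q; apply: omap_id.
- move=> q q' q'' h' h; apply/esym/omap_comp.
  exact: (pm_convex h h').
Defined.

Definition reindex_map (K L : AP) (a : hom K L) : hom (reindex_ob K) (reindex_ob L).
Proof.
refine (@NatTrans _ _ (reindex_ob K) (reindex_ob L) (fun q => ont a (u q)) _).
by move=> q q' h; apply: ont_natural.
Defined.

Definition reindex_functor : functor AP AQ.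
Proof.
refine (@Functor AP AQ reindex_ob reindex_map _ _).
- by move=> K; apply: nat_transP => q; apply: ont_id.
- by move=> K L M b a; apply: nat_transP => q; apply: ont_comp.
Defined.

Definition reindex : exact_functor AP AQ.
Proof.
refine (@ExactFunctor _ _ reindex_functor _ _ _).
- move=> K L f g; apply: nat_transP => q /=.
  by case: (u q) => [p|] /=; rewrite ?addr0.
- move=> K L f; apply: nat_kernel => q /=.
  case: (u q) => [p|] /=; first exact: kermP.
  split; first by rewrite comp0m.
  move=> t g _; exists 0; split; first by rewrite [RHS]zob_term comp0m.
  by move=> h _; rewrite [RHS]zob_term.
- move=> K L f ef; apply: nat_epi_pointwise => q /=.
  case: (u q) => [p|] /=; first exact: nat_epi.
  by move=> t g h _; rewrite [LHS]zob_init [RHS]zob_init.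
Defined.
End Functor.

(** The second condition yields naturality: when [u q] and [v q'] are both defined, neither way
    around the square may pass through a zero object. *)
Definition reindexable (u v : partial_map Q P) : Prop :=
  (forall q, ole (u q) (v q)) /\
  (forall q q', (q <= q')%O -> u q -> v q' -> u q' && v q).

Section Transformation.
Variables (u v : partial_map Q P) (uv : reindexable u v).

Definition reindex_nt_comp (K : AP) : hom (reindex u K) (reindex v K).
Proof.
refine (@NatTrans _ _ (reindex_ob u K) (reindex_ob v K) (fun q => omap K (uv.1 q)) _).
move=> q q' h /=.
have h'' : ole (u q) (v q').
  apply: (ole_trans (pm_mono u h) (uv.1 q')) => uq vq'.
  by case/andP: (uv.2 _ _ h uq vq').
transitivity (omap K h''); [|apply: esym]; apply: omap_comp => uq vq';
  by case/andP: (uv.2 _ _ h uq vq').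
Defined.

Definition reindex_nt : nat_trans (reindex u) (reindex v).
Proof.
refine (@NatTrans _ _ (reindex u) (reindex v) reindex_nt_comp _).
by move=> K L a; apply: nat_transP => q; apply/esym/ont_natural.
Defined.
End Transformation.

End Reindex.

(** * Composites of reindexing functors *)

Section Composite.
Variables (d d' : Order.disp_t) (P : porderType d) (Q : porderType d') (A : abelian).
Local Notation AP := (diagram_cat (poset_cat P) A).
Local Notation AQ := (diagram_cat (poset_cat Q) A).
Variables (v : partial_map Q P) (u : partial_map P Q).
Implicit Types (K L : AP) (o : option Q).

(** Source and target are convertible only after case analysis on [o]; this map and [join_composite]
    mediate between them. On [None], zero is the identity of the zero object. *)
Definition split_composite K o : hom (oob K (obind v o)) (oob (reindex A v K) o) :=
  match o return hom (oob K (obind v o)) (oob (reindex A v K) o) with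
  | Some q => idm _
  | None => 0
  end.

Definition join_composite K o : hom (oob (reindex A v K) o) (oob K (obind v o)) :=
  match o return hom (oob (reindex A v K) o) (oob K (obind v o)) with
  | Some q => idm _
  | None => 0
  end.

Lemma split_compositeK K o : join_composite K o \mo split_composite K o = idm _.
Proof. by case: o => [q|] /=; rewrite ?comp1m // comp0m [RHS]zob_term. Qed.

Lemma join_compositeK K o : split_composite K o \mo join_composite K o = idm _.
Proof. by case: o => [q|] /=; rewrite ?comp1m // comp0m [RHS]zob_term. Qed.

Lemma split_composite_iso K o : is_iso (split_composite K o).
Proof. by exists (join_composite K o); rewrite split_compositeK join_compositeK. Qed.

Lemma join_composite_iso K o : is_iso (join_composite K o).
Proof. by exists (split_composite K o); rewrite split_compositeK join_compositeK. Qed.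

Lemma ole_obind o o' : ole o o' -> ole (obind v o) (obind v o').
Proof. by case: o o' => [q|] [q'|] //= h; [apply: pm_mono | case: (v q)]. Qed.

Lemma split_composite_omap K o o' (h : ole o o') (h' : ole (obind v o) (obind v o')) :
  omap (reindex A v K) h \mo split_composite K o = split_composite K o' \mo omap K h'.
Proof.
case: o o' h h' => [q|] [q'|] h h' /=; rewrite ?comp0m ?compm0 //.
by rewrite compm1 comp1m; congr omap; apply: bool_irrelevance.
Qed.

Lemma join_composite_omap K o o' (h : ole o o') (h' : ole (obind v o) (obind v o')) :
  join_composite K o' \mo omap (reindex A v K) h = omap K h' \mo join_composite K o.
Proof.
rewrite -[LHS]compm1 -(join_compositeK K o) -compA (compA (omap _ _)).
by rewrite (split_composite_omap K h h') !compA split_compositeK comp1m.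
Qed.

Lemma split_composite_ont K L (a : hom K L) o :
  ont (fmap (reindex A v) a) o \mo split_composite K o =
  split_composite L o \mo ont a (obind v o).
Proof. by case: o => [q|] /=; rewrite ?compm1 ?comp1m ?comp0m. Qed.

Lemma join_composite_ont K L (a : hom K L) o :
  join_composite L o \mo ont (fmap (reindex A v) a) o =
  ont a (obind v o) \mo join_composite K o.
Proof. by case: o => [q|] /=; rewrite ?compm1 ?comp1m ?comp0m. Qed.

Section Unit.
Hypothesis le_w : forall p, ole (Some p) (obind v (u p)).
Hypothesis down_w : forall p p', (p <= p')%O -> obind v (u p') -> obind v (u p).

(** The model case is restriction to a down-set extended by zero, a quotient of the diagram; for an
    up-set it is a subdiagram, whence [up_w] in the counit. *)
Definition reindex_unit_comp K : hom K (reindex A u (reindex A v K)).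
Proof.
refine (@NatTrans _ _ (K : functor _ _) (reindex_ob u (reindex_ob v K))
  (fun p => split_composite K (u p) \mo (omap K (le_w p))) _).
move=> p p' h.
have h' := ole_obind (pm_mono u h).
have h'' : ole (Some (p : P)) (obind v (u p')) 
  by apply: (ole_trans (le_w p) h') => _; apply: down_w.
suff: split_composite K (u p') \mo omap K (le_w p') \mo
    omap K (o := Some (p : P)) (o' := Some (p' : P)) h =
  omap (reindex A v K) (pm_mono u h) \mo (split_composite K (u p) \mo omap K (le_w p)) by [].
rewrite -compA [RHS]compA (split_composite_omap K (pm_mono u h) h') -[RHS]compA.
congr (_ \mo _); transitivity (omap K h''); [|apply: esym]; apply: omap_comp => //= _.
exact: down_w.
Defined.

Definition reindex_unit :
  nat_trans (functor_id AP) (functor_comp (reindex A u) (reindex A v)).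
Proof.
refine (@NatTrans _ _ (functor_id AP) (functor_comp (reindex A u) (reindex A v))
  reindex_unit_comp _).
move=> K L a; apply: nat_transP => p.
suff: split_composite L (u p) \mo omap L (le_w p) \mo ont a (Some (p : P)) =
  ont (fmap (reindex A v) a) (u p) \mo (split_composite K (u p) \mo omap K (le_w p)) by [].
by rewrite -compA -ont_natural !compA split_composite_ont.
Defined.
End Unit.

Section Counit.
Hypothesis w_le : forall p, ole (obind v (u p)) (Some p).
Hypothesis up_w : forall p p', (p <= p')%O -> obind v (u p) -> obind v (u p').

Definition reindex_counit_comp K : hom (reindex A u (reindex A v K)) K.
Proof.
refine (@NatTrans _ _ (reindex_ob u (reindex_ob v K)) (K : functor _ _)
  (fun p => omap K (w_le p) \mo join_composite K (u p)) _).
move=> p p' h.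
have h' := ole_obind (pm_mono u h).
have h'' : ole (obind v (u p)) (Some (p' : P)).
  by apply: (ole_trans (w_le p) (o'' := Some (p' : P))).
suff: omap K (w_le p') \mo join_composite K (u p') \mo omap (reindex A v K) (pm_mono u h) =
  omap K (o := Some (p : P)) (o' := Some (p' : P)) h \mo
    (omap K (w_le p) \mo join_composite K (u p)) by [].
rewrite -compA (join_composite_omap K (pm_mono u h) h') !compA.
congr (_ \mo _); transitivity (omap K h''); [|apply: esym]; apply: omap_comp => //= w _.
exact: up_w w.
Defined.

Definition reindex_counit :
  nat_trans (functor_comp (reindex A u) (reindex A v)) (functor_id AP).
Proof.
refine (@NatTrans _ _ (functor_comp (reindex A u) (reindex A v)) (functor_id AP)
  reindex_counit_comp _).
move=> K L a; apply: nat_transP => p.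
suff: omap L (w_le p) \mo join_composite L (u p) \mo ont (fmap (reindex A v) a) (u p) =
  ont a (Some (p : P)) \mo (omap K (w_le p) \mo join_composite K (u p)) by [].
by rewrite -compA join_composite_ont !compA -ont_natural.
Defined.
End Counit.
End Composite.

Section CompositeTransformation.
Variables (d d' : Order.disp_t) (P : porderType d) (Q : porderType d') (A : abelian).
Variables (u v : partial_map Q P) (uv : reindexable u v).
Variables (K : diagram_cat (poset_cat P) A) (o : option Q).

Lemma ole_obind_reindexable : ole (obind u o) (obind v o).
Proof. by case: o => //= q; apply: uv.1. Qed.

Lemma ont_split_composite (h : ole (obind u o) (obind v o)) :
  ont (reindex_nt_comp uv K) o \mo split_composite u K o = split_composite v K o \mo omap K h.
Proof.
case: o h => [q|] h /=; last by rewrite comp0m.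
by rewrite compm1 comp1m; congr omap; apply: bool_irrelevance.
Qed.

Lemma ont_join_composite (h : ole (obind u o) (obind v o)) :
  join_composite v K o \mo ont (reindex_nt_comp uv K) o = omap K h \mo join_composite u K o.
Proof.
case: o h => [q|] h /=; last by rewrite comp0m.
by rewrite compm1 comp1m; congr omap; apply: bool_irrelevance.
Qed.

Lemma ont_reindex_iso : obind u o = obind v o -> is_iso (ont (reindex_nt_comp uv K) o).
Proof.
move=> E; have h := ole_obind_reindexable.
rewrite -[X in is_iso X]compm1 -(join_compositeK u) compA (ont_split_composite h).
by do !apply: is_iso_comp; [apply: split_composite_iso | apply: omap_iso |
  apply: join_composite_iso].
Qed.

End CompositeTransformation.

Lemma omap_reindex_iso (d d' : Order.disp_t) (P : porderType d) (Q : porderType d')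
    (A : abelian) (v : partial_map Q P) (K : diagram_cat (poset_cat P) A)
    (o o' : option Q) (h : ole o o') :
  obind v o = obind v o' -> is_iso (omap (reindex A v K) h).
Proof.
move=> E; have h' := ole_obind v h.
rewrite -[X in is_iso X]compm1 -(join_compositeK v K) compA (split_composite_omap K h h').
by do !apply: is_iso_comp; [apply: split_composite_iso | apply: omap_iso |
  apply: join_composite_iso].
Qed.

Lemma hom_oob_obind0 (d d' : Order.disp_t) (P : porderType d) (Q : porderType d')
    (A : abelian) (v : partial_map Q P) (K : diagram_cat (poset_cat P) A)
    (o : option Q) (t : A) (f : hom t (oob (reindex A v K) o)) :
  obind v o = None -> f = 0.
Proof.
case: o f => [q|] /= f E; last exact: zob_term.
by move: f; rewrite /= E => f; apply: zob_term.
Qed.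

Section ReindexEquivalence.
Variables (d d' : Order.disp_t) (P : porderType d) (Q : porderType d').
Variables (u v : partial_map Q P) (uv : reindexable u v).
Variables (u' v' : partial_map P Q) (uv' : reindexable u' v').
Hypothesis u'u : forall p, obind u (u' p) = None.
Hypothesis vv' : forall q, obind v' (v q) = None.
Hypotheses (unit1_le : forall p, ole (Some p) (obind v (u' p)))
  (unit1_down : forall p p', (p <= p')%O -> obind v (u' p') -> obind v (u' p)).
Hypotheses (unit2_le : forall p, ole (Some p) (obind u (v' p)))
  (unit2_down : forall p p', (p <= p')%O -> obind u (v' p') -> obind u (v' p)).
Hypotheses (counit1_le : forall q, ole (obind u' (v q)) (Some q))
  (counit1_up : forall q q', (q <= q')%O -> obind u' (v q) -> obind u' (v q')).
Hypotheses (counit2_le : forall q, ole (obind v' (u q)) (Some q))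
  (counit2_up : forall q q', (q <= q')%O -> obind v' (u q) -> obind v' (u q')).
Hypothesis unit_square : forall p,
  obind v (u' p) = Some p /\ obind u (v' p) = obind v (v' p) \/
  obind u (v' p) = Some p /\ obind v (u' p) = obind v (v' p).
Hypothesis counit_square : forall q,
  obind v' (u q) = Some q /\ obind u' (u q) = obind u' (v q) \/
  obind u' (v q) = Some q /\ obind u' (u q) = obind v' (u q).

Variable A : abelian.
Local Notation AP := (diagram_cat (poset_cat P) A).
Local Notation AQ := (diagram_cat (poset_cat Q) A).

(** A side of the square is invertible at [p] as soon as its two partial maps agree there, and
    [unit_square] provides two opposite sides. *)
Lemma unit_bicartesian (K : AP) :
  bicartesian (reindex_unit A unit1_le unit1_down K) (reindex_unit A unit2_le unit2_down K)
    (reindex_nt A uv' (reindex A v K)) (fmap (reindex A v') (reindex_nt A uv K)).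
Proof.
apply: bicartesian_pointwise => p.
suff: bicartesian (split_composite v K (u' p) \mo omap K (unit1_le p))
    (split_composite u K (v' p) \mo omap K (unit2_le p))
    (omap (reindex A v K) (uv'.1 p)) (ont (reindex_nt_comp uv K) (v' p)) by [].
have comm : omap (reindex A v K) (uv'.1 p) \mo
      (split_composite v K (u' p) \mo omap K (unit1_le p)) =
    ont (reindex_nt_comp uv K) (v' p) \mo (split_composite u K (v' p) \mo omap K (unit2_le p)).
  have h1 := ole_obind v (uv'.1 p); have h2 := ole_obind_reindexable uv (v' p).
  (* Both ways around the square reduce to the single map [omap K h3]. *)
  have h3 : ole (Some p) (obind v (v' p)).
    by apply: (ole_trans (unit2_le p) h2) => _; case: (unit_square p) => [[_ ->]|[-> _]].
  rewrite [LHS]compA [RHS]compA (split_composite_omap K _ h1) (ont_split_composite _ _ h2).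
  rewrite -[LHS]compA -[RHS]compA; congr (_ \mo _).
  transitivity (omap K h3); [|apply: esym]; apply: omap_comp => _;
    by case: (unit_square p) => [[E1 E2]|[E1 E2]]; rewrite ?E1 ?E2.
case: (unit_square p) => [[E1 E2]|[E1 E2]].
- apply: bicartesian_iso1 comm _ _; last exact: ont_reindex_iso.
  by apply: is_iso_comp; [apply: split_composite_iso | apply: omap_iso].
- apply: bicartesian_iso2 comm _ _; last exact: omap_reindex_iso.
  by apply: is_iso_comp; [apply: split_composite_iso | apply: omap_iso].
Qed.

Lemma counit_bicartesian (L : AQ) :
  bicartesian (reindex_nt A uv (reindex A u' L)) (fmap (reindex A u) (reindex_nt A uv' L))
    (reindex_counit A counit1_le counit1_up L) (reindex_counit A counit2_le counit2_up L).
Proof.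
apply: bicartesian_pointwise => q.
suff: bicartesian (omap (reindex A u' L) (uv.1 q)) (ont (reindex_nt_comp uv' L) (u q))
    (omap L (counit1_le q) \mo join_composite u' L (v q))
    (omap L (counit2_le q) \mo join_composite v' L (u q)) by [].
have comm : omap L (counit1_le q) \mo join_composite u' L (v q) \mo
    omap (reindex A u' L) (uv.1 q) =
    omap L (counit2_le q) \mo join_composite v' L (u q) \mo ont (reindex_nt_comp uv' L) (u q).
  have h1 := ole_obind u' (uv.1 q); have h2 := ole_obind_reindexable uv' (u q).
  have h3 : ole (obind u' (u q)) (Some q).
    by apply: (ole_trans h2 (counit2_le q)); case: (counit_square q) => [[-> _]|[_ ->]].
  rewrite -[LHS]compA -[RHS]compA (join_composite_omap L _ h1) (ont_join_composite _ _ h2).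
  rewrite [LHS]compA [RHS]compA; congr (_ \mo _).
  transitivity (omap L h3); [|apply: esym]; apply: omap_comp;
    by case: (counit_square q) => [[E1 E2]|[E1 E2]]; rewrite ?E1 ?E2.
case: (counit_square q) => [[E1 E2]|[E1 E2]].
- apply: bicartesian_iso1 comm _ _; first exact: omap_reindex_iso.
  by apply: is_iso_comp; [apply: omap_iso | apply: join_composite_iso].
- apply: bicartesian_iso2 comm _ _; first exact: ont_reindex_iso.
  by apply: is_iso_comp; [apply: omap_iso | apply: join_composite_iso].
Qed.

Lemma tri_equivalent_reindex :
  tri_equivalent (derived AP) (derived AQ) /\ tri_equivalent (derived AQ) (derived AP).
Proof.
apply: (tri_equivalent_cones _ _ unit_bicartesian counit_bicartesian).
- by move=> K T f; apply: nat_transP => p; apply: (hom_oob_obind0 (ntc f p) (u'u p)).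
- by move=> L T f; apply: nat_transP => q; apply: (hom_oob_obind0 (ntc f q) (vv' q)).
Qed.

End ReindexEquivalence.

(** * The flip of a poset *)

Section TotalMaps.
Variables (d d' : Order.disp_t) (Q : porderType d) (P : porderType d').

Definition nowhere : partial_map Q P.
Proof. by refine (@PartialMap _ _ Q P (fun=> None) _ _). Defined.

Definition everywhere (c : Q -> P) (mc : {homo c : x y / (x <= y)%O}) : partial_map Q P.
Proof. by refine (@PartialMap _ _ Q P (fun q => Some (c q)) _ _) => // q q' /mc. Defined.
End TotalMaps.

(** A degenerate case of the cone construction: with [nowhere] for [u] and [v'], the cone functors
    are restriction along [c] and shifted restriction along [e], up to isomorphism. *)
Lemma universally_derived_equivalent_iso (d d' : Order.disp_t) (P : porderType d)
    (Q : porderType d') (c : Q -> P) (e : P -> Q) :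
  {homo c : x y / (x <= y)%O} -> {homo e : x y / (x <= y)%O} ->
  cancel c e -> cancel e c -> universally_derived_equivalent P Q.
Proof.
move=> mc me ce ec A.
have uv : reindexable (nowhere Q P) (everywhere mc) by [].
have uv' : reindexable (everywhere me) (nowhere P Q) by [].
apply: (tri_equivalent_reindex uv uv' _ _ _ _ _ _ _ _ _ _ _ _ A).1 => //=.
- by move=> p; rewrite ec.
- by move=> q; rewrite ce.
- by move=> p; left; rewrite ec.
- by move=> q; right; rewrite ce.
Qed.

Section Flip.
Variables (dX dZ : Order.disp_t) (X : porderType dX) (Z : porderType dZ).
Local Notation P := (ordsum (ordsum X 'I_1) Z).
Local Notation Q := (ordsum 'I_1 (dirsum X Z)).

Lemma leI1 (i j : 'I_1) : (i <= j)%O.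
Proof. by rewrite !ord1. Qed.

Definition flip_u : partial_map Q P.
Proof.
refine (@PartialMap _ _ Q P (fun q => match q with
  | inr (inl x) => Some (inl (inl x))
  | _ => None end) _ _).
- by move=> [i|[x|z]] [j|[x'|z']].
- by move=> [i|[x|z]] [j|[x'|z']] [k|[x''|z'']].
Defined.

Definition flip_v : partial_map Q P.
Proof.
refine (@PartialMap _ _ Q P (fun q => match q with
  | inl i => Some (inl (inr i))
  | inr (inl x) => Some (inl (inr ord0))
  | inr (inr z) => Some (inr z) end) _ _) => //.
- by move=> [i|[x|z]] [j|[x'|z']] //= _; apply: leI1.
- by move=> [i|[x|z]] [j|[x'|z']] [k|[x''|z'']].
Defined.

Definition flip_u' : partial_map P Q.
Proof.
refine (@PartialMap _ _ P Q (fun p => match p with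
  | inl (inl x) => Some (inl ord0)
  | inl (inr i) => Some (inl i)
  | inr z => Some (inr (inr z)) end) _ _) => //.
- by move=> [[x|i]|z] [[x'|j]|z'] //= _; apply: leI1.
- by move=> [[x|i]|z] [[x'|j]|z'] [[x''|k]|z''].
Defined.

Definition flip_v' : partial_map P Q.
Proof.
refine (@PartialMap _ _ P Q (fun p => match p with
  | inl (inl x) => Some (inr (inl x))
  | _ => None end) _ _).
- by move=> [[x|i]|z] [[x'|j]|z'].
- by move=> [[x|i]|z] [[x'|j]|z'] [[x''|k]|z''].
Defined.

(** The points of [X] form an up-set of [Q], being incomparable there to those of [Z], and a
    down-set of [P]. This gives the second condition here and in the next lemma. *)
Lemma flip_reindexable : reindexable flip_u flip_v.
Proof. by split; [move=> [i|[x|z]] | move=> [i|[x|z]] [j|[x'|z']]]. Qed.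

Lemma flip_reindexable' : reindexable flip_u' flip_v'.
Proof. by split; [move=> [[x|i]|z] | move=> [[x|i]|z] [[x'|j]|z']]. Qed.

Lemma tri_equivalent_flip (A : abelian) :
  tri_equivalent (derived (diagram_cat (poset_cat P) A))
                 (derived (diagram_cat (poset_cat Q) A)) /\
  tri_equivalent (derived (diagram_cat (poset_cat Q) A))
                 (derived (diagram_cat (poset_cat P) A)).
Proof.
apply: (tri_equivalent_reindex flip_reindexable flip_reindexable').
- by move=> [[x|i]|z].
- by move=> [i|[x|z]].
- by move=> [[x|i]|z] /=.
- by move=> [[x|i]|z] [[x'|j]|z'].
- by move=> [[x|i]|z] /=.
- by move=> [[x|i]|z] [[x'|j]|z'].
- by move=> [i|[x|z]] /=.
- by move=> [i|[x|z]] [j|[x'|z']].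
- by move=> [i|[x|z]] /=.
- by move=> [i|[x|z]] [j|[x'|z']].
(* At points of [X], [flip_u] after [flip_v'] is the identity; elsewhere [flip_v] after [flip_u']
   is, and the opposite side is a map of zero objects. *)
- by move=> [[x|i]|z] /=; [right | left | left].
- by move=> [i|[x|z]] /=; [right | left | right].
Qed.

Definition dirsum_swap (q : Q) : ordsum 'I_1 (dirsum Z X) :=
  match q with
  | inl i => inl i
  | inr (inl x) => inr (inr x)
  | inr (inr z) => inr (inl z)
  end.

Lemma dirsum_swap_homo : {homo dirsum_swap : x y / (x <= y)%O}.
Proof. by move=> [i|[x|z]] [j|[x'|z']]. Qed.
End Flip.

Lemma dirsum_swapK (dX dZ : Order.disp_t) (X : porderType dX) (Z : porderType dZ) :
  cancel (@dirsum_swap _ _ X Z) (@dirsum_swap _ _ Z X).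
Proof. by move=> [i|[x|z]]. Qed.

Theorem corollary1p6 (dX dZ : Order.disp_t)
    (X : finPOrderType dX) (Z : finPOrderType dZ) :
  universally_derived_equivalent
    (ordsum (ordsum X 'I_1) Z) (ordsum 'I_1 (dirsum X Z)) /\
  universally_derived_equivalent
    (ordsum (ordsum X 'I_1) Z) (ordsum (ordsum Z 'I_1) X).
Proof.
split=> A; first exact: (tri_equivalent_flip X Z A).1.
(* Flip, exchange the two summands, and flip back with [X] and [Z] exchanged; the last step uses the
   reverse direction of [tri_equivalent_flip]. *)
apply: tri_equivalent_trans (tri_equivalent_flip X Z A).1 _.
apply: tri_equivalent_trans (tri_equivalent_flip Z X A).2.
exact: (universally_derived_equivalent_iso (@dirsum_swap_homo _ _ Z X)
  (@dirsum_swap_homo _ _ X Z) (@dirsum_swapK _ _ Z X) (@dirsum_swapK _ _ X Z)).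
Qed.
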